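(* Let $(X,T)$ be a minimal Cantor system of finite topological rank. Then $(X,T)$ is an odometer or is conjugate to a minimal subshift $X_V\subseteq 2^{\mathbb{Z}}$ of finite symbolic rank. Moreover, if $(X,T)$ is not an odometer, then the subshift $X_V$ can be taken to satisfy $\mathrm{rank}_{\mathrm{symb}}(X_V)\le \mathrm{rank}_{\mathrm{top}}(X,T)$.
   Context: **Subshifts.** $2^{\mathbb{Z}}=\{0,1\}^{\mathbb{Z}}$ has the product topology, $\sigma(x)(n)=x(n+1)$. A subshift is a closed set $X\subseteq 2^{\mathbb{Z}}$ with $\sigma X=X$, identified with the system $(X,\sigma)$; it is minimal if every orbit is dense in $X$. For an infinite word $V\in\{0,1\}^{\mathbb{N}}$, $X_V=\{x\in 2^{\mathbb{Z}}:$ every finite subword of $x$ is a subword of $V\}$. **Symbolic rank.** Let $\mathcal{F}$ be the set of finite $0,1$-words that begin and end with $0$. For finite $S\subseteq\mathcal{F}$ and $w\in\mathcal{F}$, a building of $w$ from $S$ consists of $v_1,\dots,v_{k+1}\in S$ and nonnegative integers $s_1,\dots,s_k$, $k\ge 1$, with $w=v_1 1^{s_1}v_2\cdots v_k1^{s_k}v_{k+1}$; then $w$ is built from $S$ starting with $v_1$. For $n\ge1$, a rank-$n$ generating sequence is a family $\{v_{i,j}\}_{i\ge0,1\le j\le n_i}$ of finite words such that for all $i\ge 0$: $n_i\le n$; $v_{0,j}=0$ for all $1\le j\le n_0$; $v_{i+1,1}$ is built from $S_i=\{v_{i,1},\dots,v_{i,n_i}\}$ starting with $v_{i,1}$; and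 $v_{i+1,j}$ is built from $S_i$ for all $2\le j\le n_{i+1}$. A rank-$n$ construction is such a sequence together with one chosen building of each $v_{i+1,j}$ from $S_i$ (that of $v_{i+1,1}$ starting with $v_{i,1}$); it is a construction of the infinite word $V=\lim_i v_{i,1}$. A subshift $X$ has finite symbolic rank if, for some $n\ge1$, $X=X_V$ for some $V$ having a rank-$n$ construction; the smallest such $n$ is the symbolic rank $\mathrm{rank}_{\mathrm{symb}}(X)$. **Topological rank.** A Cantor system $(X,T)$ is a homeomorphism $T$ of a Cantor space $X$ (zero-dimensional, perfect, compact metrizable). It is minimal if every orbit is dense, and essentially minimal if it has a unique minimal set (nonempty closed set $Y$ with $TY=Y$, minimal among such sets). Systems $(X,T)$ and $(Y,S)$ are conjugate if there is a homeomorphism $\varphi:X\to Y$ with $\varphi T=S\varphi$. A Bratteli diagram $(V,E)$ consists of vertices $V=V_0\sqcup V_1\sqcup\cdots$ and edges $E=E_1\sqcup E_2\sqcup\cdots$, all $V_n,E_n$ finite nonempty, $V_0=\{v_0\}$, with maps $\mathsf{s},\mathsf{r}:E\to V$ satisfying $\mathsf{s}(E_n)=V_{n-1}$ and $\mathsf{r}(E_n)=V_n$ for $n\ge1$ (so every vertex is a source, and every vertex other than $v_0$ is a range). It is ordered if it carries a partial order $\preceq$ on $E$ in which $e,e'$ are comparable iff $\mathsf{r}(e)=\mathsf{r}(e')$. Let $X_B=\{(e_n)_{n\ge1}: e_n\in E_n,\ \mathsf{r}(e_n)=\mathsf{s}(e_{n+1})\}$ with the subspace topology of $\prod_n E_n$.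 The ordered diagram $B$ is essentially simple if there is a unique $x_{\max}\in X_B$ all of whose edges are $\preceq$-maximal and a unique $x_{\min}\in X_B$ all of whose edges are $\preceq$-minimal. Then the Vershik map $\lambda_B$ sends $x_{\max}$ to $x_{\min}$, and sends $(e_1,e_2,\dots)\ne x_{\max}$ to $(f_1,\dots,f_k,e_{k+1},\dots)$, where $k$ is least with $e_k$ not maximal, $f_k$ is the $\preceq$-successor of $e_k$, and $(f_1,\dots,f_{k-1})$ is the unique path of minimal edges from $v_0$ to $\mathsf{s}(f_k)$. An essentially minimal Cantor system has finite topological rank if it is conjugate to some $(X_B,\lambda_B)$ with $B$ essentially simple and $(|V_n|)_{n\ge1}$ bounded by some natural number $d$; the least possible $d$ is its topological rank $\mathrm{rank}_{\mathrm{top}}(X,T)$. An (infinite) odometer is an essentially minimal Cantor system of topological rank $1$. *)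

(* Defs.v *)
From HB Require Import structures.
From mathcomp Require Import all_boot all_order all_algebra.
From mathcomp Require Import all_classical all_reals topology cantor.

Set Implicit Arguments.
Unset Strict Implicit.
Unset Printing Implicit Defensive.

Import GRing.Theory.

Local Open Scope classical_set_scope.

(* Equal to 0 when P is empty. *)
Definition least (P : set nat) : nat :=
  xget 0 [set n | P n /\ forall m, P m -> n <= m].

Definition homeomorphism (X Y : topologicalType) (f : X -> Y) : Prop :=
  exists g : Y -> X,
    [/\ cancel f g, cancel g f, continuous f & continuous g].

Definition conjugate (X Y : topologicalType) (T : X -> X) (S : Y -> Y) : Prop :=
  exists phi : X -> Y,
    homeomorphism phi /\ forall x, phi (T x) = S (phi x).

(* The choice of R is immaterial, as all realTypes are isomorphic. *)
Definition metrizable (R : realType) (X : topologicalType) : Prop :=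
  exists (M : metricType R) (f : X -> M), homeomorphism f.

Definition cantor_system (R : realType) (X : topologicalType) (T : X -> X) :
    Prop :=
  [/\ cantor_like X, metrizable R X & homeomorphism T].

(* For a bijection T this is the two-sided orbit {T^n x | n in Z}. *)
Definition orbit_of (X : Type) (T : X -> X) (x : X) : set X :=
  [set y | exists n, y = iter n T x \/ x = iter n T y].

Definition minimal_system (X : topologicalType) (T : X -> X) : Prop :=
  forall x, dense (orbit_of T x).

Definition closed_invariant (X : topologicalType) (T : X -> X) (Y : set X) :
    Prop :=
  [/\ Y !=set0, closed Y & T @` Y = Y].

Definition minimal_set (X : topologicalType) (T : X -> X) (Y : set X) : Prop :=
  closed_invariant T Y /\
  forall Z, closed_invariant T Z -> Z `<=` Y -> Z = Y.

Definition essentially_minimal (X : topologicalType) (T : X -> X) : Prop :=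
  exists! Y : set X, minimal_set T Y.

(* The symbols 0 and 1 are represented by false and true. *)
Definition word := seq bool.

Notation shift_space := (prod_topology (fun _ : int => bool)).

Definition shift_map (x : shift_space) : shift_space := fun n : int => x (n + 1)%R.

Definition subshift (X : set shift_space) : Prop :=
  closed X /\ shift_map @` X = X.

Lemma subshift_stable (X : set shift_space) (hX : subshift X) (x : X) :
  shift_map (set_val x) \in X.
Proof.
by apply: mem_set; rewrite -{1}hX.2; exists (set_val x) => //; exact: set_valP.
Qed.

Definition subshift_map (X : set shift_space) (hX : subshift X) (x : X) : X :=
  SigSub (subshift_stable hX x).

Definition subword_at (x : shift_space) (m : int) (l : nat) : word :=
  mkseq (fun k => x (m + k%:Z)%R) l.

Definition subword (u : word) (V : nat -> bool) : Prop :=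
  exists m, u = mkseq (fun k => V (m + k)) (size u).

Definition subshift_of (V : nat -> bool) : set shift_space :=
  [set x | forall m l, subword (subword_at x m l) V].

Lemma subshift_of_subshift (V : nat -> bool) : subshift (subshift_of V).
Proof.
split.
- rewrite closedE => x clx m l.
  apply: contrapT => nV; apply: clx.
  have yx : nbhs x [set y : shift_space |
      forall k, k < l -> y (m + k%:Z)%R = x (m + k%:Z)%R].
    elim: l {nV} => [|l IHl]; first exact: filterE.
    have hl : nbhs x [set y : shift_space |
        y (m + l%:Z)%R = x (m + l%:Z)%R].
      have /(_ [set x (m + l%:Z)%R]) := @proj_continuous _ (fun _ : int => bool) (m + l%:Z)%R x; apply.
      exact: discrete_set1.
    apply: filterS2 hl IHl => y yl yk k; rewrite ltnS leq_eqVlt.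
    by case/predU1P => [->|/yk].
  apply: filterS yx => y yx Vy; apply: nV.
  suff -> : subword_at x m l = subword_at y m l by exact: Vy.
  apply/eq_in_map => k; rewrite mem_iota => /andP[_ kl].
  by rewrite yx.
- rewrite eqEsubset; split => [_ [x Vx <-] m l|x Vx].
    have := Vx (m + 1)%R l; rewrite /subword_at.
    by rewrite (@eq_mkseq _ _ (fun k => shift_map x (m + k%:Z)%R))// => k;
      rewrite /shift_map addrAC.
  exists (fun n : int => x (n - 1)%R) => [m l|].
    have := Vx (m - 1)%R l; rewrite /subword_at.
    by rewrite (@eq_mkseq _ _ (fun k => x (m + k%:Z - 1)%R))// => k;
      rewrite addrAC.
  by apply: functional_extensionality_dep => n; rewrite /shift_map addrK.
Qed.

(* (v_1, [:: (s_1, v_2); ...; (s_k, v_(k+1))]) *)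
Definition building : Type := word * seq (nat * word).

Definition spell (b : building) : word :=
  b.1 ++ flatten [seq nseq p.1 true ++ p.2 | p <- b.2].

Definition is_building (S : set word) (w : word) (b : building) : Prop :=
  [/\ S b.1, b.2 <> [::], (forall p, p \in b.2 -> S p.2) & w = spell b].

(* The j-th word of level i is meaningful for 1 <= j <= nwords i only.  All
   words begin and end with 0, as this is preserved by buildings. *)
Record construction (n : nat) := Construction {
  nwords : nat -> nat;
  cword : nat -> nat -> word;
  cbuilding : nat -> nat -> building;
  nwords_bound : forall i, 1 <= nwords i <= n;
  cword0 : forall j, 1 <= j <= nwords 0 -> cword 0 j = [:: false];
  cbuildingP : forall i j, 1 <= j <= nwords i.+1 ->
    is_building [set cword i k | k in [set k | 1 <= k <= nwords i]]
      (cword i.+1 j) (cbuilding i.+1 j);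
  cbuilding_start : forall i, (cbuilding i.+1 1).1 = cword i 1;
}.

Definition construction_of (n : nat) (c : construction n) (V : nat -> bool) :
    Prop :=
  forall k, \forall i \near \oo,
    k < size (cword c i 1) /\ nth false (cword c i 1) k = V k.

Definition has_construction_rank (X : set shift_space) (n : nat) : Prop :=
  1 <= n /\ exists (V : nat -> bool) (c : construction n),
    construction_of c V /\ X = subshift_of V.

Definition finite_symbolic_rank (X : set shift_space) : Prop :=
  exists n, has_construction_rank X n.

Definition symbolic_rank (X : set shift_space) : nat :=
  least (has_construction_rank X).

(* [edge n] is the set E_(n+1) of edges from V_n to V_(n+1).  As edges of
   different levels have different ranges, the order on edges is given by its
   restriction to each level.  Nonemptiness of all levels follows from
   [top_vertex], [src_surj] and [rng_surj]. *)
Record ordered_bratteli := OrderedBratteli {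
  vertex : nat -> finType;
  edge : nat -> finType;
  src : forall n, edge n -> vertex n;
  rng : forall n, edge n -> vertex n.+1;
  top_vertex : vertex 0;
  top_vertexP : forall v : vertex 0, v = top_vertex;
  src_surj : forall n (v : vertex n), exists e, src e = v;
  rng_surj : forall n (v : vertex n.+1), exists e, rng e = v;
  edge_le : forall n, rel (edge n);
  edge_le_refl : forall n, reflexive (@edge_le n);
  edge_le_anti : forall n, antisymmetric (@edge_le n);
  edge_le_trans : forall n, transitive (@edge_le n);
  edge_comparable : forall n (e f : edge n),
    (edge_le e f || edge_le f e) = (rng e == rng f);
}.

Section PathSpace.
Variable B : ordered_bratteli.

Definition paths : set (prod_topology (fun n => discrete_topology (edge B n))) :=
  [set x | forall n, rng (x n : edge B n) = src (x n.+1 : edge B n.+1)].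

Definition path_edge (x : paths) (n : nat) : edge B n := set_val x n.

Definition maximal_edge n (e : edge B n) : Prop :=
  forall f, edge_le e f -> f = e.

Definition minimal_edge n (e : edge B n) : Prop :=
  forall f, edge_le f e -> f = e.

Definition successor_edge n (e f : edge B n) : Prop :=
  [/\ edge_le e f, f <> e &
      forall g, edge_le e g -> edge_le g f -> g = e \/ g = f].

Definition maximal_path (x : paths) : Prop :=
  forall n, maximal_edge (path_edge x n).

Definition minimal_path (x : paths) : Prop :=
  forall n, minimal_edge (path_edge x n).

Definition essentially_simple : Prop :=
  (exists! x, maximal_path x) /\ (exists! x, minimal_path x).

Definition vershik_image (x y : paths) : Prop :=
  (maximal_path x /\ minimal_path y) \/
  exists k, [/\ ~ maximal_edge (path_edge x k),
    (forall i, i < k -> maximal_edge (path_edge x i)),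
    successor_edge (path_edge x k) (path_edge y k),
    (forall i, i < k -> minimal_edge (path_edge y i)) &
    (forall i, k < i -> path_edge y i = path_edge x i)].

(* The default value x of xget is not used when B is essentially simple. *)
Definition vershik (x : paths) : paths := xget x (vershik_image x).

Lemma minimal_edge_exists n (v : vertex B n.+1) :
  exists2 e : edge B n, minimal_edge e & rng e = v.
Proof.
have [e0 re0] := rng_surj v.
have le00 : edge_le e0 e0 by exact: edge_le_refl.
case: (@arg_minnP _ e0 (fun e => edge_le e e0) (fun e => #|[pred f | edge_le f e]|) le00).
move=> e lee0 emin; exists e; last first.
  by rewrite -re0; apply/eqP; rewrite -edge_comparable lee0.
move=> f lefe; apply: (@edge_le_anti _ n); rewrite lefe /=.
have /emin := edge_le_trans lefe lee0.
rewrite leqNgt; apply: contraNT => nef; apply: proper_card; apply/properP.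
split; first by apply/fintype.subsetP => g; rewrite !inE => /edge_le_trans ->.
by exists e; rewrite !inE ?edge_le_refl.
Qed.

Lemma successor_edge_exists n (e : edge B n) :
  ~ maximal_edge e -> exists f, successor_edge e f.
Proof.
move=> /existsNP[f0 /not_implyP[lef0 nf0]].
have p0 : edge_le e f0 && (f0 != e) by rewrite lef0; apply/eqP.
case: (@arg_minnP _ f0 (fun f => edge_le e f && (f != e))
  (fun f => #|[pred g | edge_le e g && edge_le g f]|) p0).
move=> f /andP[lef /eqP nfe] fmin; exists f; split => // g leg lgf.
have [->|ge] := eqVneq g e; [by left|right].
have /fmin : edge_le e g && (g != e) by rewrite leg.
move=> h; apply: (@edge_le_anti _ n); rewrite lgf /=; move: h.
rewrite leqNgt; apply: contraNT => nfg; apply: proper_card; apply/properP.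
split; first by apply/fintype.subsetP => h; rewrite !inE => /andP[-> /edge_le_trans ->].
by exists f; rewrite !inE ?lef ?edge_le_refl // (negPf nfg).
Qed.

Lemma minimal_extension k (x : forall n, edge B n) :
  (forall i, k <= i -> rng (x i) = src (x i.+1)) ->
  exists y : paths, (forall i, i < k -> minimal_edge (path_edge y i)) /\
    (forall i, k <= i -> path_edge y i = x i).
Proof.
elim: k x => [|k IHk] x hx.
  have px : paths x by move=> n; exact: hx.
  by exists (SigSub (mem_set px)).
have [m mmin rm] := minimal_edge_exists (src (x k.+1)).
have [|y [y1 y2]] := IHk (dfwith x k m).
  move=> i; rewrite leq_eqVlt => /predU1P[<-|ki].
    by rewrite dfwithin dfwithout ?rm // neq_ltn ltnSn.
  by rewrite !dfwithout ?hx // neq_ltn ?ki // ltnS ltnW.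
exists y; split => i.
  rewrite ltnS leq_eqVlt => /predU1P[->|/y1//].
  by rewrite y2 // dfwithin.
by move=> ki; rewrite y2 ?(ltnW ki) // dfwithout // neq_ltn ki.
Qed.

Lemma minimal_edge_unique n (e f : edge B n) :
  minimal_edge e -> minimal_edge f -> rng e = rng f -> e = f.
Proof.
move=> em fm /eqP; rewrite -edge_comparable => /orP[/fm|/em] //.
Qed.

Lemma path_edgeP (x : paths) n : rng (path_edge x n) = src (path_edge x n.+1).
Proof. exact: (set_valP x n). Qed.

Lemma path_edge_inj (x y : paths) : (forall n, path_edge x n = path_edge y n) ->
  x = y.
Proof.
by move=> xy; apply: val_inj; apply: functional_extensionality_dep.
Qed.

Lemma successor_edge_unique n (e f g : edge B n) :
  successor_edge e f -> successor_edge e g -> f = g.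
Proof.
move=> [lef nef fmin] [leg neg gmin].
have : edge_le f g || edge_le g f.
  rewrite edge_comparable; apply/eqP; transitivity (rng e).
    by apply/eqP; rewrite -edge_comparable lef orbT.
  by apply/eqP; rewrite -edge_comparable leg.
by case/orP => [fg|gf]; [case: (gmin _ lef fg)|case: (fmin _ leg gf)].
Qed.

Lemma vershik_image_exists (x : paths) :
  essentially_simple -> exists! y, vershik_image x y.
Proof.
move=> [_ [z [zmin zuniq]]].
have [xmax|nxmax] := pselect (maximal_path x).
  exists z; split; first by left.
  by move=> y [[_ /zuniq]//|[k [/(_ (xmax k))]]].
have exk : exists k, ~~ `[< maximal_edge (path_edge x k) >].
  by move/existsNP : nxmax => [k nk]; exists k; apply/asboolP.
case: (ex_minnP exk) => k /asboolP nk kmin.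
have kmin' i : i < k -> maximal_edge (path_edge x i).
  move=> ik; apply: contrapT => nm.
  by have := kmin i (introN (asboolP _) nm); rewrite leqNgt ik.
have [f sf] := successor_edge_exists nk.
have rf : rng f = rng (path_edge x k).
  by case: sf => ef _ _; apply/eqP; rewrite -edge_comparable ef orbT.
have [|y [y1 y2]] := @minimal_extension k (dfwith (path_edge x) k f).
  move=> i; rewrite leq_eqVlt => /predU1P[<-|ki].
    by rewrite dfwithin dfwithout ?rf ?path_edgeP // neq_ltn ltnSn.
  by rewrite !dfwithout ?path_edgeP // neq_ltn ?ki // ltnS ltnW.
exists y; split.
  right; exists k; split => //; first by rewrite y2 // dfwithin.
  by move=> i ki; rewrite y2 ?(ltnW ki) // dfwithout // neq_ltn ki.
have yk : path_edge y k = f by rewrite y2 // dfwithin.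
move=> t [[/(_ k)//]|[l [nl lmax st tmin tx]]].
have lk : l = k.
  by case: (ltngtP l k) => // [/kmin'|/lmax].
move: lk nl lmax st tmin tx => -> _ _ st tmin tx.
apply: path_edge_inj => i; have [ik|] := ltnP i k; last first.
  rewrite leq_eqVlt => /predU1P[<-|ki].
    by rewrite yk; exact: successor_edge_unique st.
  by rewrite y2 ?(ltnW ki) // tx // dfwithout // neq_ltn ki.
have down d : d <= k -> path_edge y (k - d) = path_edge t (k - d).
  elim: d => [_|d IHd dk].
    by rewrite subn0 yk; exact: successor_edge_unique st.
  have kd : k - d.+1 < k by rewrite ltn_subrL (leq_ltn_trans _ dk).
  apply: minimal_edge_unique; [exact: y1|exact: tmin|].
  have e : (k - d.+1).+1 = k - d by rewrite subnS prednK // subn_gt0.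
  by rewrite !path_edgeP e IHd // ltnW.
by have := down (k - i) (leq_subr _ _); rewrite subKn // ltnW.
Qed.

Lemma vershikP (x : paths) : essentially_simple -> vershik_image x (vershik x).
Proof.
by move=> /(vershik_image_exists x)[y [xy _]]; apply: (xgetPex x); exists y.
Qed.

End PathSpace.

Arguments paths : clear implicits.

Definition has_bratteli_rank (X : topologicalType) (T : X -> X) (d : nat) :
    Prop :=
  exists B : ordered_bratteli,
    [/\ essentially_simple B, conjugate T (@vershik B) &
        forall n, 1 <= n -> #|vertex B n| <= d].

Definition finite_topological_rank (X : topologicalType) (T : X -> X) : Prop :=
  exists d, has_bratteli_rank T d.

Definition topological_rank (X : topologicalType) (T : X -> X) : nat :=
  least (has_bratteli_rank T).

Definition odometer (R : realType) (X : topologicalType) (T : X -> X) : Prop :=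
  [/\ cantor_system R T, essentially_minimal T, finite_topological_rank T &
      topological_rank T = 1].

(* Main.v *)
(* Clopen Kakutani-Rokhlin partitions ("towers") replace diagrams throughout: a
   diagram of rank d gives a refining sequence of partitions into at most d
   towers which separates points and whose bases shrink to one point. Take such
   a sequence with the least number r <= d of towers.

   If some partition of the sequence is expansive (the itinerary determines the
   point), then telescoping and spelling each of its towers by a recognizable
   0-1 word makes the system a subshift X_V, and the later partitions are
   exactly a rank-r construction of V.

   Otherwise every partition identifies two points x <> y. Suppose that one of
   the partitions, P, has no periodic itinerary, and let P' be a later one which
   distinguishes x from y: the towers of P' cut the P-itinerary of x and y in two
   different ways. A defect argument produces a partition between P and P' with
   fewer than r towers: among the sets of cuts refining both factorizations take
   a minimal one; then every piece between consecutive cuts is the first piece of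
   some tower of P', and the last piece of some tower. If there were as many
   pieces as towers, each piece would determine the tower it begins or ends,
   the pair of factorizations would be deterministic in both directions, and
   the itinerary would be periodic. Interpolating infinitely often contradicts
   the minimality of r. So all partitions have a periodic itinerary, and by
   minimality the system is an inverse limit of finite cycles, of rank 1. *)

Require Import Defs.
From mathcomp Require Import all_boot all_order all_algebra.
From mathcomp Require Import all_classical all_reals topology cantor.
From mathcomp Require Import zify.

Set Implicit Arguments.
Unset Strict Implicit.
Unset Printing Implicit Defensive.
Import GRing.Theory.
Local Open Scope classical_set_scope.

(** * Locally constant maps and iterates *)

(** The target carries no topology, so that one notion covers states in [nat * nat] and
    [Prop]-valued maps; for the latter the truth set is clopen. *)
Definition locally_constant (X : topologicalType) (A : Type) (f : X -> A) :=
  forall x, nbhs x [set y | f y = f x].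

Section LocallyConstant.
Variables (X : topologicalType).

Lemma locally_constant_comp (A B : Type) (g : A -> B) (f : X -> A) :
  locally_constant f -> locally_constant (g \o f).
Proof. by move=> lf x; apply: filterS (lf x) => y /= ->. Qed.

Lemma locally_constant_determined (A B : Type) (f : X -> A) (g : X -> B) :
  (forall x y, f x = f y -> g x = g y) -> locally_constant f ->
  locally_constant g.
Proof. by move=> fg lf x; apply: filterS (lf x) => y /= /fg ->. Qed.

Lemma locally_constant_pair (A B : Type) (f : X -> A) (g : X -> B) :
  locally_constant f -> locally_constant g ->
  locally_constant (fun x => (f x, g x)).
Proof.
by move=> lf lg x; apply: filterS2 (lf x) (lg x) => y /= -> ->.
Qed.

Lemma locally_constant_continuous_comp (Y : topologicalType) (A : Type)
    (f : X -> A) (g : Y -> X) :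
  continuous g -> locally_constant f -> locally_constant (f \o g).
Proof. by move=> cg lf y; apply: cg (lf (g y)). Qed.

Lemma open_locally_constant (P : X -> Prop) : locally_constant P -> open [set x | P x].
Proof.
by move=> lP; rewrite openE => x Px; apply: filterS (lP x) => y /= ->.
Qed.

Lemma closed_locally_constant (P : X -> Prop) : locally_constant P -> closed [set x | P x].
Proof.
move=> lP; rewrite -openC; apply: (@open_locally_constant (fun x => ~ P x)).
exact: locally_constant_comp.
Qed.

Lemma locally_constant_all (A : Type) (f : nat -> X -> A) n :
  (forall i, locally_constant (f i)) ->
  forall x, nbhs x [set y | forall i, i < n -> f i y = f i x].
Proof.
move=> lf x; elim: n => [|n IH]; first exact: filterE.
apply: filterS2 IH (lf n x) => y yi /= yn i.
by rewrite ltnS leq_eqVlt => /predU1P[->|/yi].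
Qed.

(** Cantor's intersection theorem: the sets containing some [F n] form a proper filter, and a
    cluster point of it lies in every closed [F n]. *)
Lemma decreasing_closed_nonempty (F : nat -> set X) :
  compact [set: X] -> (forall n, closed (F n)) ->
  (forall n, F n.+1 `<=` F n) -> (forall n, F n !=set0) ->
  exists x, forall n, F n x.
Proof.
move=> cX cF dF nF.
have dec m n : m <= n -> F n `<=` F m.
  by move=> /subnK <-; elim: (n - m) => // k IH x /dF /IH.
pose G : set_system X := [set A | exists n, F n `<=` A].
have FG : ProperFilter G.
  split; first by move=> [n Fn0]; have [x /Fn0] := nF n.
  split; first by exists 0.
    move=> A B [m mA] [n nB]; exists (maxn m n) => x xF.
    by split; [apply: mA|apply: nB]; apply: dec xF; rewrite ?leq_maxl ?leq_maxr.
  by move=> A B AB [n nA]; exists n => x /nA /AB.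
have [|x [_ xG]] := cX G FG; first by exists 0.
exists x => n; apply: cF => V /(xG (F n)); apply.
by exists n.
Qed.

End LocallyConstant.

Lemma homeomorphism_bij (X Y : topologicalType) (f : X -> Y) (g : Y -> X) :
  compact [set: X] -> hausdorff_space Y -> continuous f ->
  cancel f g -> cancel g f -> homeomorphism f.
Proof.
move=> cX hY cf fK gK; exists g; split => //.
apply/continuous_closedP => A cA.
have -> : g @^-1` A = f @` A.
  rewrite eqEsubset; split => [y Ay|_ [x Ax <-]]; first by exists (g y).
  by rewrite /preimage /= fK.
apply: compact_closed => //; apply: continuous_compact.
  exact: continuous_subspaceT.
by apply: subclosed_compact cX _.
Qed.

Section Bilateral.
Variables (X : Type) (T U : X -> X).
Hypotheses (TK : cancel T U) (UK : cancel U T).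

Definition ziter (z : int) (x : X) : X :=
  match z with Posz n => iter n T x | Negz n => iter n.+1 U x end.

Lemma ziterS z x : ziter (z + 1)%R x = T (ziter z x).
Proof.
case: z => [n|[|n]].
- by have -> : (n%:Z + 1)%R = n.+1 by lia.
- by rewrite /= UK.
have -> : (Negz n.+1 + 1)%R = Negz n by lia.
by rewrite /= UK.
Qed.

Lemma ziterP z x : ziter (z - 1)%R x = U (ziter z x).
Proof. by rewrite -{2}(subrK 1%R z) ziterS TK. Qed.

Lemma ziterD (a b : int) x : ziter (a + b)%R x = ziter a (ziter b x).
Proof.
have S n : ziter (n%:Z + b)%R x = iter n T (ziter b x).
  elim: n => [|n IH]; first by rewrite add0r.
  by rewrite (_ : (n.+1%:Z + b)%R = (n%:Z + b + 1)%R) ?ziterS ?IH//; lia.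
case: a => [n|n]; first exact: S.
elim: n => [|n IH] /=.
  by rewrite (_ : (Negz 0 + b)%R = (b - 1)%R) ?ziterP//; lia.
by rewrite (_ : (Negz n.+1 + b)%R = (Negz n + b - 1)%R) ?ziterP ?IH//; lia.
Qed.

Lemma ziterN z x : ziter (- z)%R (ziter z x) = x.
Proof. by rewrite -ziterD addNr. Qed.

Lemma iter_canc n : cancel (iter n T) (iter n U).
Proof. by elim: n => [|n IH] x //; rewrite [iter n.+1 T x]iterS iterSr TK IH. Qed.

End Bilateral.

Lemma ziter_continuous (X : topologicalType) (T U : X -> X) z :
  continuous T -> continuous U -> continuous (ziter T U z).
Proof.
have it (f : X -> X) n : continuous f -> continuous (iter n f).
  move=> cf; elim: n => [|n IH] x; first exact: cvg_id.
  by rewrite [iter n.+1 f]/(f \o iter n f); apply: continuous_comp; [exact: IH|exact: cf].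
by move=> cT cU; case: z => n; apply: it.
Qed.

(** * Towers *)

Lemma leastP (A : set nat) n : A n -> A (least A) /\ forall m, A m -> least A <= m.
Proof.
move=> An; rewrite /least; case: xgetP => [m _ []//|no]; exfalso.
have ex : exists k, `[< A k >] by exists n; apply/asboolP.
case: (ex_minnP ex) => m /asboolP Am min; apply: (no m); split => // k Ak.
by apply: min; apply/asboolP.
Qed.

(** Agreement up to [N] suffices because [A] already has an element there. This is how return times
    of two points are compared when their itineraries are known to agree only within one tower. *)
Lemma least_eq (A B : set nat) N n : A n -> n <= N ->
  (forall t, t <= N -> A t <-> B t) -> least A = least B.
Proof.
move=> An nN AB; have [lA minA] := leastP An.
have lN : least A <= N by exact: leq_trans (minA _ An) nN.
have [lB minB] := leastP (proj1 (AB _ lN) lA).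
have lBA : least B <= least A by apply: minB; apply/AB.
apply/eqP; rewrite eqn_leq lBA andbT; apply: minA; apply/AB => //.
exact: leq_trans lN.
Qed.

(* A clopen Kakutani-Rokhlin partition: [lab] is the index of the tower of a
   point, [flr] its floor, and [hgt k] the height of the k-th tower. *)
Record tower (X : Type) := Tower {
  lab : X -> nat;
  flr : X -> nat;
  hgt : nat -> nat;
}.

Definition state X (P : tower X) (x : X) := (lab P x, flr P x).

(** Not every label below [r] has to occur, so [r] is an upper bound on the number of towers. *)
Record is_tower (X : topologicalType) (T : X -> X) r (P : tower X) : Prop := {
  lab_lt : forall x, lab P x < r;
  flr_lt : forall x, flr P x < hgt P (lab P x);
  tower_step : forall x,
    ((flr P x).+1 = hgt P (lab P x) /\ flr P (T x) = 0) \/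
    state P (T x) = (lab P x, (flr P x).+1);
  tower_locally_constant : locally_constant (state P);
}.

(** The second clause puts the base of [P'] inside that of [P], so that every tower of [P'] is a
    stack of complete towers of [P]. *)
Definition refines X (P' P : tower X) :=
  (forall x y, state P' x = state P' y -> state P x = state P y) /\
  (forall x, flr P' x = 0 -> flr P x = 0).

Lemma refines_trans X (P Q S : tower X) : refines P Q -> refines Q S -> refines P S.
Proof. by move=> [a b] [c d]; split => [x y /a /c|x /b /d]. Qed.

Lemma refines_refl X (P : tower X) : refines P P. Proof. by []. Qed.

Section TowerTheory.
Variables (X : topologicalType) (T U : X -> X).
Hypotheses (TK : cancel T U) (UK : cancel U T).
Variables (r : nat) (P : tower X) (tP : is_tower T r P).

Lemma tower_up1 x : (flr P x).+1 < hgt P (lab P x) ->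
  state P (T x) = (lab P x, (flr P x).+1).
Proof. by case: (tower_step tP x) => [[-> _]|//]; rewrite ltnn. Qed.

Lemma tower_top x : (flr P x).+1 = hgt P (lab P x) -> flr P (T x) = 0.
Proof.
case: (tower_step tP x) => [[_ //]|[e1 e2] h].
by have := flr_lt tP (T x); rewrite e1 e2 h ltnn.
Qed.

Lemma tower_up i x : flr P x + i < hgt P (lab P x) ->
  state P (iter i T x) = (lab P x, flr P x + i).
Proof.
elim: i => [|i IH] h; first by rewrite addn0.
have /IH[e1 e2] : flr P x + i < hgt P (lab P x) by lia.
by rewrite iterS tower_up1 ?e1 ?e2 -addnS.
Qed.

Lemma tower_down1 x : 0 < flr P x -> state P (U x) = (lab P x, (flr P x).-1).
Proof.
move=> x0; case: (tower_step tP (U x)); rewrite UK.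
  by move=> [_ e]; rewrite e in x0.
by rewrite /state => -[-> ->].
Qed.

Lemma tower_down i x : i <= flr P x ->
  state P (iter i U x) = (lab P x, flr P x - i).
Proof.
elim: i => [|i IH] h; first by rewrite subn0.
have /IH[e1 e2] : i <= flr P x by lia.
by rewrite iterS tower_down1 ?e1 ?e2 ?subnS // subn_gt0.
Qed.

Lemma tower_below_base x : flr P x = 0 -> (flr P (U x)).+1 = hgt P (lab P (U x)).
Proof.
move=> x0; case: (tower_step tP (U x)) => [[]//|].
by rewrite UK /state => -[_]; rewrite x0.
Qed.

Lemma flr_base x : flr P (iter (flr P x) U x) = 0.
Proof. by have [_ ->] := tower_down (leqnn (flr P x)); rewrite subnn. Qed.

Lemma lab_base x : lab P (iter (flr P x) U x) = lab P x.
Proof. by have [->] := tower_down (leqnn (flr P x)). Qed.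

Lemma flr_next x : flr P (iter (hgt P (lab P x) - flr P x) T x) = 0.
Proof.
have h := flr_lt tP x.
rewrite -(prednK (_ : 0 < hgt P (lab P x) - flr P x)) ?subn_gt0 // iterS.
have /tower_up[e1 e2] : flr P x + (hgt P (lab P x) - flr P x).-1 < hgt P (lab P x).
  by lia.
by apply: tower_top; rewrite e1 e2; lia.
Qed.

End TowerTheory.

(** * Cutting towers along a set between two bases *)

Section Cut.
Variables (X : topologicalType) (T U : X -> X).
Hypotheses (TK : cancel T U) (UK : cancel U T).
Variables (r : nat) (P P' : tower X).
Hypotheses (tP' : is_tower T r P') (P'P : refines P' P).
Variable K : X -> Prop.
Hypotheses (K_state : forall x y, state P' x = state P' y -> K x -> K y)
           (K_base : forall x, flr P' x = 0 -> K x)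
           (K_sub : forall x, K x -> flr P x = 0).

Definition age x := least [set t | K (iter t U x)].
Definition gap x := least [set t | 0 < t /\ K (iter t T x)].
Definition piece x := [seq state P (iter i T x) | i <- iota 0 (gap x)].

Lemma ageP x : K (iter (age x) U x) /\ forall t, K (iter t U x) -> age x <= t.
Proof. apply: (@leastP _ (flr P' x)); apply: K_base; exact: flr_base tP' _. Qed.

Lemma age_le x : age x <= flr P' x.
Proof. by apply: (ageP x).2; apply: K_base; exact: flr_base tP' _. Qed.

Let room x := hgt P' (lab P' x) - flr P' x.

Let room_ok x : 0 < room x /\ K (iter (room x) T x).
Proof.
split; first by rewrite subn_gt0 (flr_lt tP').
by apply: K_base; exact: flr_next tP' _.
Qed.

Lemma gapP x : [/\ 0 < gap x, K (iter (gap x) T x) &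
  forall t, 0 < t -> K (iter t T x) -> gap x <= t].
Proof.
have [[h1 h2] h3] := leastP (room_ok x : [set t | 0 < t /\ K (iter t T x)] _).
by split => // t t0 Kt; apply: h3.
Qed.

Lemma gap_le x : gap x <= room x.
Proof. by have [_ _] := gapP x; apply; apply room_ok. Qed.

Lemma iter_TU i j x : i <= j -> iter i T (iter j U x) = iter (j - i) U x.
Proof.
by move=> ij; rewrite -{1}(subnKC ij) iterD (iter_canc UK).
Qed.

Lemma iter_UT i j x : i <= j -> iter i U (iter j T x) = iter (j - i) T x.
Proof.
by move=> ij; rewrite -{1}(subnKC ij) iterD (iter_canc TK).
Qed.

Lemma age_lt x : age x < gap (iter (age x) U x).
Proof.
rewrite ltnNge; apply/negP => h.
have [g0 Kg _] := gapP (iter (age x) U x).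
move: Kg; rewrite iter_TU // => /(ageP x).2; lia.
Qed.

Lemma age_eq n x : K (iter n U x) -> (forall t, t < n -> ~ K (iter t U x)) -> age x = n.
Proof.
move=> Kn nK; have [Ka le] := ageP x; apply/eqP; rewrite eqn_leq le //=.
by rewrite leqNgt; apply/negP => /nK.
Qed.

(** Equal states of [P'] evolve equally until the tower of [P'] is left, and the next cut comes at
    that moment at the latest. *)
Lemma state_gap x y : state P' x = state P' y -> gap x = gap y /\ piece x = piece y.
Proof.
move=> xy; have [xy1 xy2] := xy.
have st i : i < room x -> state P' (iter i T x) = state P' (iter i T y).
  move=> ir; rewrite !(tower_up tP') ?xy1 ?xy2 //; move: ir; rewrite /room -?xy1 -?xy2; lia.
have rE : room x = room y by rewrite /room xy1 xy2.
have gE : gap x = gap y.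
  have [g0 Kg _] := gapP x.
  apply: (@least_eq _ _ (room x) (gap x)) => //; first exact: gap_le.
  (* At time [room x] itself the states may differ, but both points are then on the base of [P'],
     hence in [K]. *)
  move=> t; rewrite leq_eqVlt => /predU1P[->|tr]; split => -[t0 Kt]; split => //.
  - by rewrite rE; exact: (room_ok y).2.
  - exact: (room_ok x).2.
  - by apply: K_state Kt; exact: st.
  - by apply: K_state Kt; rewrite st.
split => //; rewrite /piece -gE; apply/eq_in_map => i; rewrite mem_iota => /= ig.
by apply: P'P.1; apply: st; have := gap_le x; lia.
Qed.

Lemma state_age x y : state P' x = state P' y -> age x = age y.
Proof.
move=> xy; have [xy1 xy2] := xy; have [Ka _] := ageP x.
apply: (@least_eq _ _ (flr P' x) (age x)) => //; first exact: age_le.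
have st t : t <= flr P' x -> state P' (iter t U x) = state P' (iter t U y).
  by move=> tf; rewrite !(tower_down UK tP') -?xy1 -?xy2.
by move=> t /st /= e; split; apply: K_state.
Qed.

Lemma state_age_base x y : state P' x = state P' y ->
  state P' (iter (age x) U x) = state P' (iter (age y) U y).
Proof.
move=> xy; have [xy1 xy2] := xy; rewrite -(state_age xy).
have := age_le x => h.
by rewrite !(tower_down UK tP') -?xy1 -?xy2.
Qed.

Variable ws : seq (seq (nat * nat)).
Hypothesis pieces_ws : forall x, K x -> piece x \in ws.

(** There is one tower per word of [ws]: pieces with the same [P]-itinerary are merged even if they
    lie in different towers of [P']. This merging is what can lower the number of towers. *)
Definition cut_tower := Tower
  (fun x => index (piece (iter (age x) U x)) ws) age
  (fun k => size (nth [::] ws k)).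

Lemma hgt_cut_tower x : hgt cut_tower (lab cut_tower x) = gap (iter (age x) U x).
Proof.
by rewrite /= nth_index ?pieces_ws ?size_map ?size_iota //; apply (ageP x).1.
Qed.

Lemma cut_towerP : is_tower T (size ws) cut_tower.
Proof.
split => [x|x|x|].
- by rewrite index_mem pieces_ws //; apply (ageP x).1.
- by rewrite hgt_cut_tower /= age_lt.
- rewrite hgt_cut_tower /=; set b := iter (age x) U x.
  have xb : T x = iter (age x).+1 T b by rewrite /b iterS iter_TU ?subnn.
  have [Kb _] := ageP x; have [g0 Kg gmin] := gapP b.
  have := age_lt x; rewrite -/b leq_eqVlt => /predU1P[e|lt]; [left|right].
    by split => //; apply: age_eq => //=; rewrite xb e.
  have aE : age (T x) = (age x).+1.
    apply: age_eq; first by rewrite iterSr TK.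
    move=> t ta; rewrite xb iter_UT; last exact: ltnW.
    by move=> /gmin; rewrite subn_gt0 => /(_ ta); lia.
  by rewrite /state /= aE iterSr TK.
- apply: locally_constant_determined (tower_locally_constant tP') => x y xy.
  rewrite /state /= (state_age xy); congr (index _ _, _).
  by have [_] := state_gap (state_age_base xy); rewrite (state_age xy).
Qed.

Lemma cut_tower_refines : refines cut_tower P.
Proof.
split => [x y|x /= x0]; last by apply: K_sub; have [] := ageP x; rewrite x0.
rewrite /state /= => -[e a].
have pE : piece (iter (age x) U x) = piece (iter (age y) U y).
  have hx := pieces_ws (ageP x).1; have hy := pieces_ws (ageP y).1.
  by rewrite -(nth_index [::] hx) e nth_index.
have st z : state P z = nth (0, 0) (piece (iter (age z) U z)) (age z).
  have h := age_lt z.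
  rewrite (nth_map 0) ?size_iota // nth_iota // add0n.
  by rewrite iter_TU ?subnn.
by have := st x; rewrite pE a -st.
Qed.

Lemma refines_cut_tower : refines P' cut_tower.
Proof.
split => [x y xy|x x0].
  rewrite /state /= (state_age xy); congr (index _ _, _).
  by have [_] := state_gap (state_age_base xy); rewrite (state_age xy).
by apply: age_eq => //; exact: K_base.
Qed.

End Cut.

(** * The defect argument *)

Section Defect.
Variables (X : topologicalType) (T U : X -> X).
Hypotheses (TK : cancel T U) (UK : cancel U T).
Variables (r : nat) (P P' : tower X).
Hypotheses (tP' : is_tower T r P') (P'P : refines P' P).
Variables x y : X.
Hypothesis xyP : forall z, state P (ziter T U z x) = state P (ziter T U z y).

(** The points [u] and [v] sit at the same time on the orbits of [x] and [y], that is, at one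
    position of the common [P]-itinerary, which [P'] factors in two ways. *)
Definition pair_orbit u v := exists z, u = ziter T U z x /\ v = ziter T U z y.

Lemma pair_orbitT u v : pair_orbit u v -> pair_orbit (T u) (T v).
Proof. by move=> [z [-> ->]]; exists (z + 1)%R; rewrite !ziterS. Qed.

Lemma pair_orbitU u v : pair_orbit u v -> pair_orbit (U u) (U v).
Proof. by move=> [z [-> ->]]; exists (z - 1)%R; rewrite !ziterP. Qed.

Lemma pair_orbit_iterT n u v : pair_orbit u v -> pair_orbit (iter n T u) (iter n T v).
Proof. by elim: n => //= n IH /IH /pair_orbitT. Qed.

Lemma pair_orbit_iterU n u v : pair_orbit u v -> pair_orbit (iter n U u) (iter n U v).
Proof. by elim: n => //= n IH /IH /pair_orbitU. Qed.

Lemma pair_orbit_state u v : pair_orbit u v -> state P u = state P v.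
Proof. by move=> [z [-> ->]]. Qed.

(** By the last clause the cuts fall at the same times along both orbits, which yields one common
    refinement of the two factorizations. *)
Definition cut_set (K : X -> Prop) := [/\
  forall u v, state P' u = state P' v -> K u -> K v,
  forall u, flr P' u = 0 -> K u,
  forall u, K u -> flr P u = 0 &
  forall u v, pair_orbit u v -> K u <-> K v].

Section Pieces.
Variable K : X -> Prop.
Hypothesis cK : cut_set K.

Let K_state : forall u v, state P' u = state P' v -> K u -> K v.
Proof. by case: cK. Qed.
Let K_base : forall u, flr P' u = 0 -> K u. Proof. by case: cK. Qed.
Let K_sub : forall u, K u -> flr P u = 0. Proof. by case: cK. Qed.
Let K_pair : forall u v, pair_orbit u v -> K u <-> K v. Proof. by case: cK. Qed.

Local Notation gap := (gap T K).
Local Notation age := (age U K).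
Local Notation piece := (piece T P K).

Definition current u := piece (iter (age u) U u).

Lemma current_state u v : state P' u = state P' v -> current u = current v.
Proof.
move=> uv; have e := state_age_base UK tP' K_state K_base uv.
by have [] := state_gap tP' P'P K_state K_base e.
Qed.

Lemma piece_pair u v : pair_orbit u v -> piece u = piece v.
Proof.
move=> uv; rewrite /piece.
have -> : gap u = gap v.
  have [g0 Kg _] := gapP tP' K_base u.
  apply: (@least_eq _ _ (gap u) (gap u)) => // t _.
  by have := K_pair (pair_orbit_iterT t uv) => e; split => -[? ?]; split => //; apply/e.
by apply: eq_map => i; apply: pair_orbit_state; exact: pair_orbit_iterT.
Qed.

Lemma current_pair u v : pair_orbit u v -> current u = current v.
Proof.
move=> uv; rewrite /current.
have -> : age u = age v.
  have [Ka _] := ageP UK tP' K_base u.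
  apply: (@least_eq _ _ (age u) (age u)) => // t _.
  exact: K_pair (pair_orbit_iterU t uv).
by apply: piece_pair; exact: pair_orbit_iterU.
Qed.

Lemma current_gap u : K u -> current (U (iter (gap u) T u)) = piece u.
Proof.
move=> Ku; have [g0 Kg gmin] := gapP tP' K_base u.
rewrite -{1}(prednK g0) iterS TK /current.
have aE : age (iter (gap u).-1 T u) = (gap u).-1.
  apply: (age_eq UK tP' K_base); first by rewrite (iter_UT TK) // subnn.
  move=> t tg; rewrite (iter_UT TK); last exact: ltnW.
  by move=> /gmin; lia.
by rewrite aE (iter_UT TK) // subnn.
Qed.

(** A label that does not occur gets the piece at the default [x]. This is harmless: the list of
    first pieces only has to contain every piece. *)
Definition first_piece k := piece (xget x [set b | state P' b = (k, 0)]).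

Definition last_piece k :=
  current (xget x [set b | lab P' b = k /\ (flr P' b).+1 = hgt P' k]).

Lemma first_pieceE u : flr P' u = 0 -> first_piece (lab P' u) = piece u.
Proof.
move=> u0; rewrite /first_piece; case: xgetP => [b _ /= bu|/(_ u) []].
  by have [|_ ->] := @state_gap _ _ _ _ _ tP' P'P _ K_state K_base b u; rewrite ?bu /state ?u0.
by rewrite /= /state u0.
Qed.

Lemma last_pieceE u : (flr P' u).+1 = hgt P' (lab P' u) ->
  last_piece (lab P' u) = current u.
Proof.
move=> ut; rewrite /last_piece; case: xgetP => [b _ /= [bu bh]|/(_ u) []//].
by apply: current_state; rewrite /state bu; congr pair; lia.
Qed.

End Pieces.
End Defect.

Lemma int_pigeonhole (S : finType) (f : int -> S) :
  exists a p, 0 < p /\ f a = f (a + Posz p)%R.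
Proof.
apply: contrapT => no.
have inj : injective (fun i : 'I_(#|S|.+1) => f (Posz i)).
  move=> i j /= e; apply: contrapT => /eqP; rewrite neq_ltn => /orP[ij|ji]; apply: no.
    by exists (Posz i), (j - i); rewrite subn_gt0; split => //; rewrite e -PoszD subnKC // ltnW.
  by exists (Posz j), (i - j); rewrite subn_gt0; split => //; rewrite -e -PoszD subnKC // ltnW.
by have := leq_card _ inj; rewrite card_ord ltnn.
Qed.

(** * Minimal cut sets and determinism of the pair *)

Section Defect.
Variables (X : topologicalType) (T U : X -> X).
Hypotheses (TK : cancel T U) (UK : cancel U T).
Variables (r : nat) (P P' : tower X).
Hypotheses (tP' : is_tower T r P') (P'P : refines P' P).
Variables x y : X.
Hypothesis xyP : forall z, state P (ziter T U z x) = state P (ziter T U z y).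

Let H := \sum_(k < r) hgt P' k.

Let flr_ltH u : flr P' u < H.
Proof.
apply: leq_trans (flr_lt tP' u) _.
by rewrite /H (bigD1 (Ordinal (lab_lt tP' u))) //= leq_addr.
Qed.

(** States of [P'] as elements of a finite type ([H] exceeds every floor), so that cut sets can be
    minimized by cardinality and pairs of states must recur. *)
Definition ord_state u : 'I_r * 'I_H :=
  (Ordinal (lab_lt tP' u), Ordinal (flr_ltH u)).

Lemma ord_stateP u v : ord_state u = ord_state v <-> state P' u = state P' v.
Proof.
split=> [[a b]|[a b]]; first by rewrite /state a b.
by congr pair; apply: val_inj.
Qed.

Local Notation cut_set := (cut_set T U P P' x y).
Local Notation pair_orbit := (pair_orbit T U x y).

(* Minimality of the cut set is what makes every piece a first and a last piece. *)
Lemma minimal_cut_set : exists K : X -> Prop, cut_set K /\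
  forall K' : X -> Prop, cut_set K' -> (forall u, K' u -> K u) -> forall u, K u -> K' u.
Proof.
pose mem (K : {set 'I_r * 'I_H}) u : Prop := ord_state u \in K.
pose set_of (K : X -> Prop) : {set 'I_r * 'I_H} :=
  [set s | `[< exists u, ord_state u = s /\ K u >]]%SET.
have mem_set_of K : cut_set K -> forall u, mem (set_of K) u <-> K u.
  move=> [Kst _ _ _] u; rewrite /mem inE; split=> [/asboolP[v [/ord_stateP vu Kv]]|Ku].
    exact: Kst Kv.
  by apply/asboolP; exists u.
have cut_mem K : cut_set K -> cut_set (mem (set_of K)).
  move=> cK; have E := mem_set_of K cK; case: cK => a b c d; split.
  - by move=> u v uv /E /(a _ _ uv) /E.
  - by move=> u /b /E.
  - by move=> u /E /c.
  - move=> u v /d uv; split; first by move=> /E /uv /E.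
    by move=> /E /uv /E.
have cut0 : cut_set (fun u => flr P u = 0).
  split => [u v /P'P.1[_ ->]|u|u|u v uv] //; first by apply P'P.
  by have [_ ->] := pair_orbit_state xyP uv.
case: (@arg_minnP _ (set_of (fun u => flr P u = 0)) (fun K => `[< cut_set (mem K) >])
         (fun K => #|K|)).
  by apply/asboolP; exact: cut_mem.
move=> K /asboolP cK Kmin; exists (mem K); split => // K' cK' K'K u Ku.
have sub : (set_of K' \subset K)%SET.
  apply/fintype.subsetP => s; rewrite inE => /asboolP[v [<- K'v]].
  exact: K'K.
have : set_of K' = K.
  by apply/eqP; rewrite eqEcard sub; apply: Kmin; apply/asboolP; exact: cut_mem.
by move=> e; apply/(mem_set_of _ cK'); rewrite e.
Qed.

Variable K : X -> Prop.
Hypothesis cK : cut_set K.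
Hypothesis K_min :
  forall K' : X -> Prop, cut_set K' -> (forall u, K' u -> K u) -> forall u, K u -> K' u.

Let K_state : forall u v, state P' u = state P' v -> K u -> K v.
Proof. by case: cK. Qed.
Let K_base : forall u, flr P' u = 0 -> K u. Proof. by case: cK. Qed.
Let K_sub : forall u, K u -> flr P u = 0. Proof. by case: cK. Qed.
Let K_pair : forall u v, pair_orbit u v -> K u <-> K v. Proof. by case: cK. Qed.

Local Notation gap := (gap T K).
Local Notation age := (age U K).
Local Notation piece := (piece T P K).
Local Notation current := (current T U P K).
Local Notation first_piece := (first_piece T P P' x K).
Local Notation last_piece := (last_piece T U P P' x K).

(** Otherwise all cuts that open a copy of this piece could be deleted: no base point is lost, and
    paired points are deleted together, so a smaller cut set would remain. *)
Lemma piece_first u : K u -> piece u \in mkseq first_piece r.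
Proof.
move=> Ku; apply: contrapT => nf.
suff /(_ u Ku)[] : forall v, K v -> K v /\ piece v <> piece u by [].
apply: K_min => [|v []//]; split => [v w vw [Kv pv]|v v0|v [/K_sub//]|v w vw].
- split; first exact: K_state vw Kv.
  by have [_ <-] := state_gap tP' P'P K_state K_base vw.
- split; first exact: K_base.
  rewrite -(first_pieceE tP' P'P cK) // => e; apply: nf.
  by rewrite -e map_f // mem_iota /= (lab_lt tP').
- by rewrite (piece_pair UK tP' xyP cK vw); split=> -[/(K_pair vw)].
Qed.

(** The mirror image: if no tower ended with this piece, all cuts that close a copy of it could be
    deleted. Here [w] is the cut closing the piece that starts at [u]. *)
Lemma piece_last u : K u -> piece u \in mkseq last_piece r.
Proof.
move=> Ku; rewrite -(current_gap TK UK tP' cK Ku).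
have [_ Kw _] := gapP tP' K_base u.
set w := iter _ T u in Kw *.
apply: contrapT => nf.
have base v : flr P' v = 0 -> current (U v) <> current (U w).
  move=> v0 e; apply: nf; rewrite -e.
  rewrite -(last_pieceE UK tP' P'P cK (tower_below_base UK tP' v0)).
  by rewrite map_f // mem_iota /= (lab_lt tP').
suff /(_ w Kw)[] : forall v, K v -> K v /\ current (U v) <> current (U w) by [].
apply: K_min => [|v []//]; split => [v v' vv' [Kv cv]|v v0|v [/K_sub//]|v v' vv'].
- split; first exact: K_state vv' Kv.
  have [v0|v1] := posnP (flr P' v'); first exact: base.
  rewrite (_ : current (U v') = current (U v)) //.
  have [l f] := vv'; apply: (current_state UK tP' P'P cK).
  by rewrite !(tower_down1 UK tP') ?l ?f.
- by split; [exact: K_base|exact: base].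
- rewrite (current_pair TK UK tP' xyP cK (pair_orbitU TK UK vv')).
  by split=> -[/(K_pair vv')].
Qed.

Hypothesis first_inj : {in [pred k | k < r] &, injective first_piece}.
Hypothesis last_inj : {in [pred k | k < r] &, injective last_piece}.

Let base_state u v : flr P' u = 0 -> flr P' v = 0 -> piece u = piece v ->
  state P' u = state P' v.
Proof.
move=> u0 v0; rewrite -!(first_pieceE tP' P'P cK) // => /first_inj.
by rewrite !inE !(lab_lt tP') /state u0 v0 => ->.
Qed.

Let top_state u v : (flr P' u).+1 = hgt P' (lab P' u) ->
  (flr P' v).+1 = hgt P' (lab P' v) -> current u = current v ->
  state P' u = state P' v.
Proof.
move=> ut vt; rewrite -!(last_pieceE UK tP' P'P cK) // => /last_inj.
rewrite !inE !(lab_lt tP') /state => e; congr pair; first exact: e.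
by apply: succn_inj; rewrite ut vt e.
Qed.

Let stateT u v : state P' u = state P' v ->
  state P' (T u) = state P' (T v) \/ flr P' (T u) = 0 /\ flr P' (T v) = 0.
Proof.
move=> [l f]; have [ut|ut] := eqVneq (flr P' u).+1 (hgt P' (lab P' u)).
  by right; rewrite !(tower_top tP') // -l -f.
have lt : (flr P' u).+1 < hgt P' (lab P' u) by rewrite ltn_neqAle ut (flr_lt tP').
by left; rewrite !(tower_up1 tP') -?l -?f.
Qed.

Let stateU u v : state P' u = state P' v ->
  state P' (U u) = state P' (U v) \/
  [/\ flr P' u = 0, flr P' v = 0, (flr P' (U u)).+1 = hgt P' (lab P' (U u)) &
  (flr P' (U v)).+1 = hgt P' (lab P' (U v))].
Proof.
move=> [l f]; have [u0|u0] := posnP (flr P' u).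
  by right; split; rewrite -?f // !(tower_below_base UK tP') -?f.
by left; rewrite !(tower_down1 UK tP') -?l -?f.
Qed.

Lemma pair_synchronizedT u v : pair_orbit u v -> state P' u = state P' v ->
  state P' (T u) = state P' (T v).
Proof.
move=> uv /stateT[//|[u0 v0]]; apply: base_state => //.
exact: (piece_pair UK tP' xyP cK (pair_orbitT UK uv)).
Qed.

Lemma pair_synchronizedU u v : pair_orbit u v -> state P' u = state P' v ->
  state P' (U u) = state P' (U v).
Proof.
move=> uv /stateU[//|[_ _ ut vt]]; apply: top_state => //.
exact: (current_pair TK UK tP' xyP cK (pair_orbitU TK UK uv)).
Qed.

(** Paired base points open the same piece, so by injectivity of [first_piece] they have the same
    state. Injectivity of [first_piece] carries this equality forward and that of [last_piece]
    backward, until it reaches [x] and [y]. *)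
Lemma base_never_shared : state P' x <> state P' y ->
  forall u v, pair_orbit u v -> flr P' u = 0 -> flr P' v = 0 -> False.
Proof.
move=> nxy u v uv u0 v0.
have uv' : state P' u = state P' v.
  by apply: base_state => //; exact: (piece_pair UK tP' xyP cK uv).
suff both n : state P' (iter n T u) = state P' (iter n T v) /\
              state P' (iter n U u) = state P' (iter n U v).
  have all z : state P' (ziter T U z u) = state P' (ziter T U z v).
    by case: z => n; [apply (both n).1|apply (both n.+1).2].
  case: uv {u0 v0 uv' both} all => z [-> ->] /(_ (- z)%R).
  by rewrite !(ziterN TK UK).
elim: n => [//|n [IHT IHU]]; split.
  by apply: pair_synchronizedT => //; exact: pair_orbit_iterT.
by apply: pair_synchronizedU => //; exact: pair_orbit_iterU.
Qed.

(** A state leaves its successor open only when a new tower is entered. Both points of a pair never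
    enter one at once, so the state of one is known, and its piece, shared by the other, names the
    tower that the other enters. Backward, the last pieces play this part. *)
Lemma pair_deterministic u v u' v' : state P' x <> state P' y ->
  pair_orbit u v -> pair_orbit u' v' ->
  state P' u = state P' u' -> state P' v = state P' v' ->
  (state P' (T u) = state P' (T u') /\ state P' (T v) = state P' (T v')) /\
  (state P' (U u) = state P' (U u') /\ state P' (U v) = state P' (U v')).
Proof.
move=> nxy uv uv' eu ev; have no := base_never_shared nxy.
have K_eq w w' : state P' w = state P' w' -> K w <-> K w'.
  by move=> e; split; apply: K_state.
have pT := pair_orbitT UK uv; have pT' := pair_orbitT UK uv'.
have pU := pair_orbitU TK UK uv; have pU' := pair_orbitU TK UK uv'.
have pcE w w' : state P' w = state P' w' -> piece w = piece w'.
  by move=> e; have [] := state_gap tP' P'P K_state K_base e.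
have cuE := current_state UK tP' P'P cK.
have pp := piece_pair UK tP' xyP cK.
have cp := current_pair TK UK tP' xyP cK.
split.
  case: (stateT eu) => [Eu|[u0 u0']]; case: (stateT ev) => [Ev|[v0 v0']] //.
  - split => //; apply: base_state => //.
    by rewrite -(pp _ _ pT) (pcE _ _ Eu) (pp _ _ pT').
  - split => //; apply: base_state => //.
    by rewrite (pp _ _ pT) (pcE _ _ Ev) (pp _ _ pT').
  - by case: (no _ _ pT).
case: (stateU eu) => [Eu|[u0 u0' ut ut']]; case: (stateU ev) => [Ev|[v0 v0' vt vt']] //.
- split => //; apply: top_state => //.
  by rewrite -(cp _ _ pU) (cuE _ _ Eu) (cp _ _ pU').
- split => //; apply: top_state => //.
  by rewrite (cp _ _ pU) (cuE _ _ Ev) (cp _ _ pU').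
- by case: (no _ _ uv).
Qed.

(** Among finitely many pairs of states one recurs along the orbit, and determinism spreads the
    recurrence to all times in both directions. *)
Lemma pair_periodic : state P' x <> state P' y ->
  exists p, 0 < p /\
    forall z : int, state P (ziter T U (z + Posz p)%R x) = state P (ziter T U z x).
Proof.
move=> nxy.
pose s z := (ord_state (ziter T U z x), ord_state (ziter T U z y)).
have [a [p [p0 e]]] := int_pigeonhole s; exists p; split => // z.
pose D (b : int) := state P' (ziter T U (b + Posz p)%R x) = state P' (ziter T U b x) /\
  state P' (ziter T U (b + Posz p)%R y) = state P' (ziter T U b y).
have po b : pair_orbit (ziter T U b x) (ziter T U b y) by exists b.
have Da : D a.
  have /= /ord_stateP ex := congr1 fst e; have /= /ord_stateP ey := congr1 snd e.
  by rewrite /D ex ey.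
have DS b : D b -> D (b + 1)%R /\ D (b - 1)%R.
  move=> [D1 D2]; have [[]] := pair_deterministic nxy (po _) (po _) D1 D2.
  rewrite /D !(addrAC b _ (Posz p)) !(ziterS UK) !(ziterP TK UK) => a1 a2 [a3 a4].
  by split.
suff : D z by case=> /P'P.1.
have Dn n : D (a + Posz n)%R /\ D (a - Posz n)%R.
  elim: n => [|n [IH1 IH2]]; first by split; rewrite ?subr0 ?addr0.
  split; first by rewrite (_ : (a + Posz n.+1)%R = (a + Posz n + 1)%R); [exact: (DS _ IH1).1|lia].
  by rewrite (_ : (a - Posz n.+1)%R = (a - Posz n - 1)%R); [exact: (DS _ IH2).2|lia].
have [m [->|->]] : exists m : nat, (z = a + Posz m \/ z = a - Posz m)%R.
- by case E : (z - a)%R => [m|m]; [exists m; left|exists m.+1; right]; clear -E; lia.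
- exact: (Dn m).1.
- exact: (Dn m).2.
Qed.

End Defect.

(** If first or last pieces of two labels coincide, the corresponding list without repetitions has
    fewer than [r] entries and still contains every piece, so cutting gives [Q]. If neither happens,
    the itinerary of [x] is periodic. *)
Lemma defect_tower (X : topologicalType) (T U : X -> X) r (P P' : tower X) x y :
  cancel T U -> cancel U T ->
  is_tower T r P' -> refines P' P ->
  (forall z, state P (ziter T U z x) = state P (ziter T U z y)) ->
  state P' x <> state P' y ->
  (forall p, 0 < p ->
     ~ forall z : int, state P (ziter T U (z + Posz p)%R x) = state P (ziter T U z x)) ->
  exists r' Q, [/\ r' < r, is_tower T r' Q, refines P' Q & refines Q P].
Proof.
move=> TK UK tP' P'P xyP nxy nper.
have [K [cK K_min]] := minimal_cut_set tP' P'P xyP.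
have [a b c d] := cK.
have from g : (forall u, K u -> piece T P K u \in mkseq g r) ->
    ~ {in [pred k | k < r] &, injective g} ->
    exists r' Q, [/\ r' < r, is_tower T r' Q, refines P' Q & refines Q P].
  move=> gP ninj; have nu : ~~ uniq (mkseq g r).
    by apply/negP => /mkseq_uniqP.
  have ws u : K u -> piece T P K u \in undup (mkseq g r).
    by rewrite mem_undup; exact: gP.
  exists (size (undup (mkseq g r))), (cut_tower T U P K (undup (mkseq g r))); split.
  - by rewrite -{2}(size_mkseq g r) ltn_size_undup.
  - exact: (cut_towerP TK UK tP' P'P).
  - exact: (refines_cut_tower UK tP' P'P).
  - exact: (cut_tower_refines UK tP').
have pf := piece_first UK tP' P'P xyP cK K_min.
have pl := piece_last TK UK tP' P'P xyP cK K_min.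
have [fi|/(from _ pf)//] := pselect {in [pred k | k < r] &, injective (first_piece T P P' x K)}.
have [li|/(from _ pl)//] := pselect {in [pred k | k < r] &, injective (last_piece T U P P' x K)}.
have [p [p0 per]] := pair_periodic TK UK tP' P'P xyP cK fi li nxy.
by case: (nper _ p0).
Qed.

(** * Sequences of towers *)

(** The last clause is the uniqueness of a point on all bases; its existence comes from compactness,
    in [tower_seq_basepoint]. *)
Record tower_seq (X : topologicalType) (T : X -> X) r (P : nat -> tower X) : Prop := {
  tower_seq_tower : forall n, is_tower T r (P n);
  tower_seq_refines : forall n, refines (P n.+1) (P n);
  tower_seq_separates : forall x y, (forall n, state (P n) x = state (P n) y) -> x = y;
  tower_seq_base : forall x y, (forall n, flr (P n) x = 0) ->
    (forall n, flr (P n) y = 0) -> x = y;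
}.

Definition expansive_at X (T U : X -> X) (P : tower X) :=
  forall x y, (forall z, state P (ziter T U z x) = state P (ziter T U z y)) -> x = y.

Definition periodic_at X (T U : X -> X) (P : tower X) := exists x p, 0 < p /\
  forall z : int, state P (ziter T U (z + Posz p)%R x) = state P (ziter T U z x).

Lemma is_tower_leq (X : topologicalType) (T : X -> X) r r' (P : tower X) :
  r <= r' -> is_tower T r P -> is_tower T r' P.
Proof.
by move=> rr' [a b c d]; split => // x; exact: leq_trans (a x) rr'.
Qed.

Lemma tower_subseq_refines X (P : nat -> tower X) :
  (forall n, refines (P n.+1) (P n)) -> forall m n, m <= n -> refines (P n) (P m).
Proof.
move=> PP m n /subnK <-; elim: (n - m) => [|k IH]; first exact: refines_refl.
by rewrite addSn; apply: refines_trans IH.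
Qed.

Lemma tower_seq_interleave (X : topologicalType) (T : X -> X) r r'
    (P Q : nat -> tower X) (f : nat -> nat) :
  tower_seq T r P -> (forall n, n <= f n) -> (forall n, is_tower T r' (Q n)) ->
  (forall n, refines (Q n.+1) (Q n)) -> (forall n, refines (Q n) (P (f n))) ->
  tower_seq T r' Q.
Proof.
move=> tP fn tQ QQ QP; have PP := tower_subseq_refines (tower_seq_refines tP).
split => // x y.
  move=> xy; apply: (tower_seq_separates tP) => n.
  by apply: (PP _ _ (fn n)).1; apply: (QP n).1.
move=> x0 y0; apply: (tower_seq_base tP) => n; apply: (PP _ _ (fn n)).2; exact: (QP n).2.
Qed.

(** * Lowering the number of towers *)

Section Reduction.
Variables (X : topologicalType) (T U : X -> X).
Hypotheses (TK : cancel T U) (UK : cancel U T).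

Lemma tower_seq_reduce r (P : nat -> tower X) : tower_seq T r P ->
  (forall n, ~ expansive_at T U (P n)) -> (exists n, ~ periodic_at T U (P n)) ->
  exists r', r' < r /\ exists Q, tower_seq T r' Q.
Proof.
move=> tP nexp [n0 nper].
have PP := tower_subseq_refines (tower_seq_refines tP).
(* The number of towers gained may vary with [n]; stating the bound [r.-1] makes it uniform. Taking
   the maximum with [n0] keeps the lower partition without periodic itineraries. *)
have step n : exists mQ : nat * tower X, [/\ n < mQ.1, is_tower T r.-1 mQ.2,
    0 < r, refines (P mQ.1) mQ.2 & refines mQ.2 (P (maxn n0 n))].
  have /existsNP[x /existsNP[y /not_implyP[xy nxy]]] := nexp (maxn n0 n).
  have [m nm] : exists m, state (P m) x <> state (P m) y.
    by apply/existsNP => e; apply: nxy; exact: (tower_seq_separates tP).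
  (* Late enough to refine the lower partition, to distinguish [x] from [y], and to go beyond
     [n]. *)
  pose M := maxn (maxn n0 n) (maxn m n.+1).
  have [|||||r' [Q [rr tQ PQ QP]]] := @defect_tower X T U r (P (maxn n0 n)) (P M) x y TK UK.
  - exact: (tower_seq_tower tP).
  - by apply: PP; rewrite leq_maxl.
  - exact: xy.
  - move=> e; apply: nm; apply: (PP m M _).1 => //.
    by rewrite /M !leq_max leqnn orbT.
  - move=> p p0 per; apply: nper; exists x, p; split => // z.
    by apply: (PP n0 (maxn n0 n) _).1; rewrite ?leq_maxl.
  exists (M, Q); split => //=; last by lia.
    by rewrite /M !leq_max ltnSn !orbT.
  by apply: is_tower_leq tQ; lia.
have [next nextP] := choice step.
pose ns k := iter k (fun n => (next n).1) n0.
exists r.-1; split; first by have [_ _] := nextP 0; case: (r).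
exists (fun k => (next (ns k)).2).
have ns_ge k : maxn k n0 <= ns k.
  elim: k => [|k IH]; first by rewrite max0n.
  have [lt _ _ _ _] := nextP (ns k).
  by move: IH lt; rewrite /ns iterS -/(ns k) !geq_max => /andP[a b] c; apply/andP; split; lia.
have nsE k : maxn n0 (ns k) = ns k.
  by apply/maxn_idPr; have := ns_ge k; rewrite geq_max => /andP[].
apply: (tower_seq_interleave (f := ns) tP) => k.
- by have := ns_ge k; rewrite geq_max => /andP[].
- by have [] := nextP (ns k).
- have [_ _ _ a _] := nextP (ns k); have [_ _ _ _ b] := nextP (ns k.+1).
  by apply: refines_trans b _; rewrite nsE.
- by have [_ _ _ _] := nextP (ns k); rewrite nsE.
Qed.

Lemma tower_seq_dichotomy r (P : nat -> tower X) : tower_seq T r P ->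
  exists r' Q, [/\ r' <= r, tower_seq T r' Q &
    (exists n, expansive_at T U (Q n)) \/ forall n, periodic_at T U (Q n)].
Proof.
elim/ltn_ind: r P => r IH P tP.
have [ex|nex] := pselect (exists n, expansive_at T U (P n)).
  by exists r, P; split => //; left.
have [per|nper] := pselect (forall n, periodic_at T U (P n)).
  by exists r, P; split => //; right.
have [r' [rr [Q tQ]]] : exists r', r' < r /\ exists Q, tower_seq T r' Q.
  apply: (tower_seq_reduce tP); last exact/existsNP.
  by move=> n e; apply: nex; exists n.
have [r'' [S [a b c]]] := IH _ rr _ tQ.
by exists r'', S; split => //; lia.
Qed.

End Reduction.

(** * Minimality: aperiodicity and growth of heights *)

Section Minimal.
Variables (X : topologicalType) (T U : X -> X).
Hypotheses (TK : cancel T U) (UK : cancel U T).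
Hypotheses (cT : continuous T) (cU : continuous U).
Hypotheses (cX : compact [set: X]) (hX : hausdorff_space X).
Hypotheses (pX : perfect_set [set: X]) (mT : minimal_system T).

(** A periodic orbit is finite, hence closed, hence by density the whole space; then [x] would be
    isolated in a perfect space. *)
Lemma minimal_aperiodic x q : 0 < q -> iter q T x <> x.
Proof.
move=> q0 qx; have acX := accessible_finite_set_closed.1 (hausdorff_accessible hX).
pose S : set X := [set iter i T x | i in `I_q].
have fS : finite_set S by apply: finite_image; exact: finite_II.
have modq n : iter n T x = iter (n %% q) T x.
  rewrite {1}(divn_eq n q) addnC iterD; congr (iter _ T _).
  by elim: (n %/ q) => //= k IH; rewrite mulSn iterD IH.
have ST y : S y.
  apply: contrapT => nSy.
  have [] := mT x (ex_intro (~` S) y nSy); first by rewrite openC; exact: acX.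
  move=> w [Sw [n [wE|xE]]]; apply: Sw.
    by exists (n %% q); rewrite /= ?ltn_mod // -modq.
  (* On the cycle, [n * q.-1] steps forward undo [n] steps, because together they make [n * q]. *)
  exists ((n * q.-1) %% q); rewrite /= ?ltn_mod // -modq.
  apply: (can_inj (iter_canc TK n)); rewrite -iterD -xE -mulnS prednK // modq.
  by rewrite modnMl.
have /perfectTP/(_ x) := pX; apply; rewrite -[X in open X]setCK openC.
apply: acX => //.
by apply: sub_finite_set fS.
Qed.

Lemma flr_iter_locally_constant r (P : tower X) z : is_tower T r P ->
  locally_constant (fun x => flr P (ziter T U z x)).
Proof.
move=> tP; apply: (@locally_constant_continuous_comp _ _ _ (flr P) (ziter T U z)).
  exact: ziter_continuous.
exact: (locally_constant_comp snd (tower_locally_constant tP)).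
Qed.

Lemma hgt_refines r r' (P P' : tower X) h : is_tower T r P -> is_tower T r' P' ->
  refines P' P -> (forall x, h < hgt P (lab P x)) -> forall x, h < hgt P' (lab P' x).
Proof.
move=> tP tP' P'P hP x; set b := iter (flr P' x) U x.
have b0 : flr P' b = 0 := flr_base UK tP' x.
rewrite -(lab_base UK tP' x) -/b; apply: leq_trans (hP b) _.
rewrite leqNgt; apply/negP => lt.
have := flr_next tP' b; rewrite b0 subn0 => /P'P.2 e.
have pb : flr P b = 0 by exact: P'P.2.
have [_] : state P (iter (hgt P' (lab P' b)) T b) = (lab P b, flr P b + hgt P' (lab P' b)).
  by apply: (tower_up tP); rewrite pb add0n.
by rewrite e pb add0n => h0; have := flr_lt tP' b; rewrite b0 -[X in _ < X]h0.
Qed.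

(** If every partition had a tower of height at most [h], compactness would give a point on all
    bases with a bounded return to each base. One return time then works for all levels, and as only
    one point lies on all bases, the point would be periodic. *)
Lemma hgt_unbounded r (P : nat -> tower X) h : tower_seq T r P ->
  exists m, forall x, h < hgt (P m) (lab (P m) x).
Proof.
move=> tP; apply: contrapT => no.
have PP := tower_seq_refines tP.
pose F m := [set x | flr (P m) x = 0 /\ exists q, q < h /\ flr (P m) (iter q.+1 T x) = 0].
have FS m : F m.+1 `<=` F m.
  by move=> x [/(PP m).2 x0 [q [qh /(PP m).2 q0]]]; split => //; exists q.
have [|m|x xF] := decreasing_closed_nonempty cX _ FS.
- move=> m; apply: closed_locally_constant => x.
  have lc q : locally_constant (fun x => flr (P m) (iter q T x)).
    exact: (@flr_iter_locally_constant _ _ (Posz q) (tower_seq_tower tP m)).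
  apply: filterS (locally_constant_all h.+1 lc x) => y yx; apply/propext.
  split=> -[x0 [q [qh q0]]]; split.
  + by have /= <- := yx 0 (ltn0Sn _).
  + by exists q; split => //; rewrite -yx.
  + by have /= -> := yx 0 (ltn0Sn _).
  + by exists q; split => //; rewrite yx.
- have tm := tower_seq_tower tP m.
  have [x xh] : exists x, hgt (P m) (lab (P m) x) <= h.
    by apply: contrapT => /forallNP nh; apply: no; exists m => x; rewrite ltnNge; apply/negP.
  pose b := iter (flr (P m) x) U x; have b0 : flr (P m) b = 0 := flr_base UK tm x.
  have hb : hgt (P m) (lab (P m) b) = hgt (P m) (lab (P m) x) by rewrite (lab_base UK tm).
  exists b; split => //; exists (hgt (P m) (lab (P m) b)).-1.
  have := flr_lt tm b; rewrite b0 => h0; rewrite prednK //; split; first by rewrite hb; lia.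
  by have := flr_next tm b; rewrite b0 subn0.
(* If each of the finitely many times failed at some level, all would fail at the largest of these
   levels, as bases decrease. *)
have [q [qh qF]] : exists q, q < h /\ forall m, flr (P m) (iter q.+1 T x) = 0.
  apply: contrapT => nq.
  have /choice[f fP] : forall q : 'I_h, exists m, flr (P m) (iter q.+1 T x) <> 0.
    by move=> q; apply/existsNP => e; apply: nq; exists (val q); split; [exact: ltn_ord|exact: e].
  have [_ [q [qh q0]]] := xF (\max_q f q).
  apply: (fP (Ordinal qh)); apply: (tower_subseq_refines PP _).2 q0.
  exact: leq_bigmax.
apply: (@minimal_aperiodic x q.+1) => //; apply: (tower_seq_base tP) => //.
by move=> m; have [] := xF m.
Qed.

End Minimal.

(** * The symbolic model *)

Lemma conjugate_minimal (X Y : topologicalType) (T : X -> X) (S : Y -> Y) :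
  conjugate T S -> minimal_system T -> minimal_system S.
Proof.
move=> [phi [[psi [phiK psiK cphi cpsi]] phiT]] mT y O [z Oz] oO.
have iterS n w : phi (iter n T w) = iter n S (phi w).
  by elim: n => //= n <-.
have [||x [Ox [n xn]]] := mT (psi y) (phi @^-1` O); first by exists (psi z); rewrite /preimage /= psiK.
  by apply: open_comp => // w _; exact: cphi.
exists (phi x); split => //; exists n.
by case: xn => [->|yx]; [left|right]; rewrite ?iterS ?psiK // -iterS -yx psiK.
Qed.

(** Runs of 1 become exponents, and the appended 0 closes the last run. This builds the words of
    level 1 from the single word 0. *)
Lemma zero_spelling (w : word) : exists ps : seq (nat * word),
  (forall p, p \in ps -> p.2 = [:: false]) /\ ps <> [::] /\
  rcons w false = flatten [seq nseq p.1 true ++ p.2 | p <- ps].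
Proof.
elim: w => [|[] w [ps [ps0 [psn e]]]].
- by exists [:: (0, [:: false])]; split => // p; rewrite inE => /eqP ->.
- case: ps ps0 psn e => // -[s v] ps ps0 _ e; exists ((s.+1, v) :: ps); split.
    move=> p; rewrite inE => /predU1P[->|pps]; first exact: (ps0 (s, v)) (mem_head _ _).
    by apply: ps0; rewrite inE pps orbT.
  by split => //=; rewrite e.
- exists ((0, [:: false]) :: ps); split.
    by move=> p; rewrite inE => /predU1P[->|/ps0].
  by split => //=; rewrite e.
Qed.

(** * Subspaces of products *)

Section SubProduct.
Variables (I : choiceType) (K : I -> topologicalType) (A : set (prod_topology K)).

Lemma coordinate_continuous (z : I) : continuous (fun x : A => set_val x z).
Proof.
move=> x; apply: (@continuous_comp A (prod_topology K) (K z) set_val (@proj I K z)).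
  exact: initial_continuous.
exact: proj_continuous.
Qed.

Lemma continuous_to_subproduct (X : topologicalType) (f : X -> A) :
  (forall z, locally_constant (fun x => set_val (f x) z)) -> continuous f.
Proof.
move=> lf; apply: continuous_comp_initial => x; apply/cvg_sup => z U.
move=> [? [[W oW <-] Wfx] WU]; apply: filterS (lf z x) => y /= yx.
by apply: WU; rewrite /preimage /= yx.
Qed.

Lemma hausdorff_subproduct : (forall z, hausdorff_space (K z)) -> hausdorff_space A.
Proof.
move=> hK x y cxy; apply: val_inj; apply: functional_extensionality_dep => z.
apply: hK => V W /(coordinate_continuous (z := z) (x := x)) Vx.
move=> /(coordinate_continuous (z := z) (x := y)) Wy.
by have [w [Vw Ww]] := cxy _ _ Vx Wy; exists (set_val w z).
Qed.

End SubProduct.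


(** * Coding an expansive sequence of towers by a subshift *)

Section Symbolic.
Variables (X : topologicalType) (T U : X -> X).
Hypotheses (TK : cancel T U) (UK : cancel U T).
Hypotheses (cT : continuous T) (cU : continuous U).
Hypotheses (cX : compact [set: X]) (mT : minimal_system T).

(** Minimality speaks of two-sided orbits only. If the forward orbit of [x] missed [O], then
    [iter N T x] would miss it during the times from [-N] to [N], and compactness would give a point
    whose whole orbit misses it. *)
Lemma forward_dense x (O : X -> Prop) : locally_constant O -> (exists y, O y) ->
  exists k, O (iter k T x).
Proof.
move=> lO Oy; apply: contrapT => no.
pose D N := [set y | forall i, i <= N -> ~ O (iter i T y) /\ ~ O (iter i U y)].
have lc z : locally_constant (fun y => O (ziter T U z y)).
  by apply: (@locally_constant_continuous_comp _ _ _ O); [exact: ziter_continuous|].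
have [|N y yD i iN|N|y yD] := decreasing_closed_nonempty cX (F := D).
- move=> N; apply: closed_locally_constant => y.
  have l1 i : locally_constant (fun y => O (iter i T y)) by exact: (lc (Posz i)).
  have l2 i : locally_constant (fun y => O (iter i U y)).
    by case: i => [//|i]; exact: (lc (Negz i)).
  apply: filterS2 (locally_constant_all N.+1 l1 y) (locally_constant_all N.+1 l2 y).
  move=> w w1 w2; apply/propext; split=> h i iN; have [a b] := h i iN.
    by rewrite -w1 // -w2.
  by rewrite w1 // w2.
- by apply: yD; rewrite leqW.
- exists (iter N T x) => i iN; split => Oi; apply: no.
    by exists (i + N); rewrite iterD.
  by exists (N - i); rewrite -(iter_UT TK).
have [||w [Ow [n wn]]] := mT y (O := [set y | O y]) => //; first exact: open_locally_constant.
have [n1 n2] := yD n n (leqnn _); case: wn => [wE|yE]; first by apply: n1; rewrite -wE.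
by apply: n2; rewrite yE (iter_canc TK).
Qed.

Variables (r : nat) (P : nat -> tower X) (x0 : X).
Hypotheses (tP : tower_seq T r P) (exP : expansive_at T U (P 0)).
Hypotheses (P_tall : forall x, r + 5 < hgt (P 0) (lab (P 0) x))
  (P_grow : forall n x y, hgt (P n) (lab (P n) x) < hgt (P n.+1) (lab (P n.+1) y)).
Hypothesis x0P : forall n, flr (P n) x0 = 0.

Let tPn n : is_tower T r (P n) := tower_seq_tower tP n.
Let PP := tower_subseq_refines (tower_seq_refines tP).

(* The floors of the tower of index [l] and height [h] spell the word
   0 1^(l+1) 0 1^(h-l-4) 0, so that 00 occurs exactly where two towers meet. *)
Definition symbol x : bool :=
  ~~ [|| flr (P 0) x == 0, (flr (P 0) x).+1 == hgt (P 0) (lab (P 0) x)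
       | flr (P 0) x == (lab (P 0) x).+2].

Lemma symbol_state n x y : state (P n) x = state (P n) y -> symbol x = symbol y.
Proof. by move=> /(PP (leq0n n)).1[e f]; rewrite /symbol e f. Qed.

Lemma symbol_locally_constant z : locally_constant (fun x => symbol (ziter T U z x)).
Proof.
apply: (@locally_constant_continuous_comp _ _ _ symbol); first exact: ziter_continuous.
apply: locally_constant_determined (tower_locally_constant (tPn 0)).
exact: symbol_state.
Qed.

Lemma symbol_base x : flr (P 0) (T x) = 0 <-> symbol x = false /\ symbol (T x) = false.
Proof.
have hx := P_tall x; have lx := lab_lt (tPn 0) x; have fx := flr_lt (tPn 0) x.
split=> [Tx0|[]].
  have := tower_below_base UK (tPn 0) Tx0; rewrite TK /symbol Tx0 => ->.
  by rewrite !eqxx !orbT.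
(* Within one tower the zeros stand on floors 0, [l + 2] and [h - 1]; as [l < r] and [r + 5 < h], no
   two of these are adjacent. *)
case: (tower_step (tPn 0) x) => [[_ //]|[e f]].
have := flr_lt (tPn 0) (T x); rewrite /symbol e f => h1 /negbFE a /negbFE b.
by exfalso; lia.
Qed.

Definition same_symbols u v := forall z, symbol (ziter T U z u) = symbol (ziter T U z v).

Lemma same_symbolsC u v : same_symbols u v -> same_symbols v u.
Proof. by move=> uv z; rewrite uv. Qed.

Lemma same_symbols_ziter u v z : same_symbols u v ->
  same_symbols (ziter T U z u) (ziter T U z v).
Proof. by move=> uv z'; rewrite -!(ziterD TK UK). Qed.

Lemma same_symbols_base u v : same_symbols u v -> flr (P 0) u = 0 -> flr (P 0) v = 0.
Proof.
move=> uv u0; rewrite -(UK v); apply/symbol_base.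
have /symbol_base : flr (P 0) (T (U u)) = 0 by rewrite UK.
rewrite -[U u]/(ziter T U (Negz 0) u) -[U v]/(ziter T U (Negz 0) v) uv.
by rewrite /ziter /= !UK; have := uv 0%R; rewrite /= => ->.
Qed.

Lemma same_symbols_flr u v : same_symbols u v -> flr (P 0) v <= flr (P 0) u.
Proof.
move=> uv; rewrite leqNgt; apply/negP => lt.
have := flr_base UK (tPn 0) u; set i := flr _ u in lt * => iu.
have : flr (P 0) (iter i U v) = 0.
  apply: same_symbols_base iu; case: i {lt} => [//|i].
  exact: (same_symbols_ziter (Negz i) uv).
by have [_ ->] := tower_down UK (tPn 0) (ltnW lt); lia.
Qed.

(** With a smaller label, [v] would read its inner 0 on floor [lab (P 0) v + 2], where [u] is still
    in its first run of 1. *)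
Lemma same_symbols_lab u v : same_symbols u v -> flr (P 0) u = 0 ->
  flr (P 0) v = 0 -> lab (P 0) u <= lab (P 0) v.
Proof.
move=> uv u0 v0; rewrite leqNgt; apply/negP => lt.
have := uv (Posz (lab (P 0) v).+2); rewrite /= /symbol -!iterS.
have hu := P_tall u; have hv := P_tall v.
have lu := lab_lt (tPn 0) u; have lv := lab_lt (tPn 0) v.
have /(tower_up (tPn 0))[-> ->] :
  flr (P 0) u + (lab (P 0) v).+2 < hgt (P 0) (lab (P 0) u) by lia.
have /(tower_up (tPn 0))[-> ->] :
  flr (P 0) v + (lab (P 0) v).+2 < hgt (P 0) (lab (P 0) v) by lia.
by rewrite u0 v0 !add0n eqxx !orbT /= => /negbFE; lia.
Qed.

Lemma same_symbols_state u v : same_symbols u v -> state (P 0) u = state (P 0) v.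
Proof.
move=> uv; have fE : flr (P 0) u = flr (P 0) v.
  by apply/eqP; rewrite eqn_leq !same_symbols_flr //; exact: same_symbolsC.
congr pair => //; rewrite -(lab_base UK (tPn 0) u) -(lab_base UK (tPn 0) v) -fE.
have bu := flr_base UK (tPn 0) u; have := flr_base UK (tPn 0) v; rewrite -fE => bv.
have buv : same_symbols (iter (flr (P 0) u) U u) (iter (flr (P 0) u) U v).
  case: (flr (P 0) u) => [//|i]; exact: (same_symbols_ziter (Negz i) uv).
by apply/eqP; rewrite eqn_leq !same_symbols_lab //; exact: same_symbolsC.
Qed.

Lemma same_symbols_eq u v : same_symbols u v -> u = v.
Proof. by move=> uv; apply: exP => z; apply: same_symbols_state; exact: same_symbols_ziter. Qed.

Definition limit_word k := symbol (iter k T x0).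

Definition itinerary x : shift_space := fun z => symbol (ziter T U z x).

Lemma itinerary_subshift x : subshift_of limit_word (itinerary x).
Proof.
move=> m l; pose y := ziter T U m x.
have [||k kP] := @forward_dense x0
    (fun w => forall i, i < l -> symbol (iter i T w) = symbol (iter i T y)).
- move=> w; have lc i : locally_constant (fun x => symbol (iter i T x)).
    exact: (symbol_locally_constant (Posz i)).
  apply: filterS (locally_constant_all l lc w) => w' ww'.
  by apply/propext; split=> h i il; rewrite -(h i il) ww'.
- by exists y.
exists k; rewrite size_mkseq; apply/eq_in_map => i; rewrite mem_iota /= => il.
rewrite /limit_word addnC iterD kP // /itinerary /y.
by rewrite -[iter i T _]/(ziter T U (Posz i) _) -(ziterD TK UK) addrC.
Qed.

(** Each central window of [v] occurs in the limit word, hence around some point of the forward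
    orbit of [x0]; the point sought comes from compactness. The shift by [N] below moves the
    occurrence from its left end to its centre. *)
Lemma itinerary_surjective v : subshift_of limit_word v -> exists x, itinerary x = v.
Proof.
move=> Vv.
pose F N := [set x | forall i, i < N.*2.+1 ->
  symbol (ziter T U (Posz i - Posz N)%R x) = v (Posz i - Posz N)%R].
have [|N x xF i iN|N|x xF] := decreasing_closed_nonempty cX (F := F).
- move=> N; apply: closed_locally_constant => x.
  apply: filterS (locally_constant_all N.*2.+1
    (fun i => symbol_locally_constant (Posz i - Posz N)%R) x) => y yx.
  by apply/propext; split=> h i iN; rewrite -h // yx.
- have := xF i.+1; rewrite (_ : (Posz i.+1 - Posz N.+1)%R = (Posz i - Posz N)%R); last by lia.
  by apply; lia.
- have [k] := Vv (- Posz N)%R N.*2.+1; rewrite size_mkseq => e.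
  exists (iter (k + N) T x0) => i iN.
  have := congr1 (fun s => nth false s i) e; rewrite !nth_mkseq // [(_ + Posz i)%R]addrC => ->.
  rewrite /limit_word -[iter (k + N) T x0]/(ziter T U (Posz (k + N)) x0).
  rewrite -(ziterD TK UK) -[iter (k + i) T x0]/(ziter T U (Posz (k + i)) x0).
  by congr (symbol (ziter T U _ x0)); lia.
exists x; apply: functional_extensionality_dep => z; rewrite /itinerary.
have [N [i [iN zE]]] : exists N i, i < N.*2.+1 /\ z = (Posz i - Posz N)%R.
  case: z => n; first by exists n, n.*2; split; lia.
  by exists n.+1, 0; split; lia.
by rewrite zE; apply: xF.
Qed.

Lemma symbolic_conjugate :
  conjugate T (subshift_map (subshift_of_subshift limit_word)).
Proof.
pose phi x : subshift_of limit_word := SigSub (mem_set (itinerary_subshift x)).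
have /choice[psi psiP] : forall v : subshift_of limit_word, exists x, itinerary x = set_val v.
  by move=> v; apply: itinerary_surjective; exact: set_valP.
have psiK : cancel psi phi by move=> v; apply: val_inj; exact: psiP.
have phi_inj : injective phi.
  move=> x y /(congr1 set_val) /= xy; apply: same_symbols_eq => z.
  exact: (congr1 (fun f => f z) xy).
exists phi; split.
  apply: (homeomorphism_bij (g := psi)) => //.
  - apply: hausdorff_subproduct => z; exact: discrete_hausdorff.
  - by apply: continuous_to_subproduct => z; exact: symbol_locally_constant.
  - by move=> x; apply: phi_inj; rewrite psiK.
move=> x; apply: val_inj; apply: functional_extensionality_dep => z.
rewrite -[LHS]/(symbol (ziter T U z (T x))).
by rewrite -[RHS]/(symbol (ziter T U (z + 1)%R x)) (ziterD TK UK).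
Qed.

(* A transposition, so that index 1 designates the tower of [x0]. *)
Definition label_of_index n j :=
  if j == 1 then lab (P n) x0 else if j.-1 == lab (P n) x0 then 0 else j.-1.

Lemma label_of_index_surj n k : k < r ->
  exists j, 1 <= j <= r /\ label_of_index n j = k.
Proof.
move=> kr; have l0 := lab_lt (tPn n) x0; rewrite /label_of_index.
have [->|kl] := eqVneq k (lab (P n) x0); first by exists 1; split => //; lia.
have [k0|k0] := posnP k.
  exists (lab (P n) x0).+1; split; first by lia.
  by rewrite /= eqxx ifF; lia.
by exists k.+1; split; [lia|rewrite /= (negbTE kl) ifF //; lia].
Qed.

(** The default [x0] lies on every base, so that an index without a tower still yields a base
    point. *)
Definition base_of_index n j := xget x0 [set b | state (P n) b = (label_of_index n j, 0)].

Lemma base_of_indexP n j : flr (P n) (base_of_index n j) = 0.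
Proof. by rewrite /base_of_index; case: xgetP => [b _ [_ ->]|]. Qed.

Lemma base_of_indexE n j b : state (P n) b = (label_of_index n j, 0) ->
  state (P n) (base_of_index n j) = state (P n) b.
Proof. by move=> bE; rewrite /base_of_index; case: xgetP => [c _ ->|/(_ b)]. Qed.

Lemma base_of_index1 n : state (P n) (base_of_index n 1) = state (P n) x0.
Proof. by apply: base_of_indexE; rewrite /state x0P. Qed.

Definition symbols_upto N b : word := mkseq (fun t => symbol (iter t T b)) N.

Definition tower_word n b : word := symbols_upto (hgt (P n) (lab (P n) b)) b.

Lemma tower_word_state n b b' : flr (P n) b = 0 -> state (P n) b = state (P n) b' ->
  tower_word n b = tower_word n b'.
Proof.
move=> b0 bb'; have [l f] := bb'; rewrite /tower_word l.
apply/eq_in_map => t; rewrite mem_iota /= add0n -l => tb.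
apply: (@symbol_state n).
have /(tower_up (tPn n)) -> : flr (P n) b + t < hgt (P n) (lab (P n) b) by rewrite b0.
have /(tower_up (tPn n)) -> : flr (P n) b' + t < hgt (P n) (lab (P n) b') by rewrite -f -l b0.
by rewrite -f -l.
Qed.

Lemma symbols_uptoD M N b : symbols_upto (M + N) b = symbols_upto M b ++ symbols_upto N (iter M T b).
Proof.
rewrite /symbols_upto /mkseq iotaD map_cat; congr (_ ++ _).
rewrite add0n -[in LHS](addn0 M) iotaDl -map_comp; apply: eq_map => t /=.
by rewrite addnC iterD.
Qed.

Lemma tower_word_decomposition n N b : flr (P n) b = 0 -> flr (P n) (iter N T b) = 0 ->
  exists s : seq word, (forall w, w \in s -> exists b', flr (P n) b' = 0 /\ w = tower_word n b') /\
    symbols_upto N b = flatten s.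
Proof.
elim/ltn_ind: N b => -[_ b _ _|N IH b b0 bN]; first by exists [::].
set h := hgt (P n) (lab (P n) b).
have hN : h <= N.+1.
  rewrite leqNgt; apply/negP => lt.
  have /(tower_up (tPn n))[_] : flr (P n) b + N.+1 < h by rewrite b0.
  by rewrite bN b0.
have h0 : 0 < h by have := flr_lt (tPn n) b; rewrite b0.
have [|||s [sP e]] := IH (N.+1 - h) _ (iter h T b); first by lia.
- by have := flr_next (tPn n) b; rewrite b0 subn0.
- by rewrite -iterD subnK.
exists (tower_word n b :: s); split; last by rewrite -(subnKC hN) symbols_uptoD e.
by move=> w; rewrite inE => /predU1P[->|/sP//]; exists b.
Qed.

(** Levels are shifted by one: the partition [P n] gives the words of level [n.+1], and level 0 is
    reserved for the word 0. *)
Definition level_word i j : word :=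
  if i is n.+1 then tower_word n (base_of_index n j) else [:: false].

Lemma tower_word_level n b : flr (P n) b = 0 ->
  exists2 j, 1 <= j <= r & level_word n.+1 j = tower_word n b.
Proof.
move=> b0; have [j [jr jl]] := label_of_index_surj n (lab_lt (tPn n) b).
exists j => //=; apply: tower_word_state; first exact: base_of_indexP.
by apply: base_of_indexE; rewrite /state jl b0.
Qed.

(** Above level 1 all exponents are 0, since the tower words follow one another directly. Index 1
    always designates the tower of [x0], whose bottom subtower is again that of [x0]; this gives the
    starting word. *)
Lemma level_building i j : exists B : building,
  is_building [set level_word i k | k in [set k | 1 <= k <= r]] (level_word i.+1 j) B /\
  (j = 1 -> B.1 = level_word i 1).
Proof.
set b := base_of_index i j; have b0 : flr (P i) b = 0 := base_of_indexP i j.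
have r0 : 0 < r by exact: leq_ltn_trans (lab_lt (tPn 0) x0).
case: i @b b0 => [|i] b b0.
  have hb := P_tall b; set h := hgt _ _ in hb.
  have wE : level_word 1 j = false :: rcons (mkseq (fun t => symbol (iter t.+1 T b)) h.-2) false.
    rewrite /level_word -/b /tower_word /symbols_upto -/h.
    rewrite {1}(_ : h = 1 + (h.-2 + 1)); last by lia.
    rewrite [mkseq _ (1 + _)]/= /mkseq /= (iotaD 1 h.-2 1) map_cat -cats1; congr (_ :: _ ++ _).
    - by rewrite /symbol b0 eqxx.
    - by rewrite -[in LHS](addn0 1) iotaDl -map_comp.
    - rewrite /= /symbol; have /(tower_up (tPn 0))[-> ->] : flr (P 0) b + (1 + h.-2) < h by lia.
      by rewrite b0 -/h (_ : (0 + (1 + h.-2)).+1 == h) ?orbT //; lia.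
  have [ps [ps0 [psn e]]] := zero_spelling (mkseq (fun t => symbol (iter t.+1 T b)) h.-2).
  exists ([:: false], ps); split => //; split => //=.
  - by exists 1.
  - by move=> p /ps0 ->; exists 1.
  - by rewrite -[tower_word 0 _]/(level_word 1 j) wE e.
have c0 : flr (P i) b = 0 by exact: (tower_seq_refines tP i).2.
set h := hgt (P i.+1) (lab (P i.+1) b); set h' := hgt (P i) (lab (P i) b).
(* Strict growth leaves something above the first subtower, so that the building has at least two
   words. *)
have hh : h' < h by exact: P_grow.
have n1 : flr (P i) (iter h' T b) = 0 by have := flr_next (tPn i) b; rewrite c0 subn0.
have n2 : flr (P i) (iter (h - h') T (iter h' T b)) = 0.
  rewrite -iterD subnK; last exact: ltnW.
  by apply: (tower_seq_refines tP i).2; have := flr_next (tPn i.+1) b; rewrite b0 subn0.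
have [s [sP e]] := tower_word_decomposition n1 n2.
exists (tower_word i b, [seq (0, w) | w <- s]); split; last first.
  move=> j1; apply: tower_word_state => //.
  rewrite base_of_index1; apply: (tower_seq_refines tP i).1.
  by rewrite /b j1 base_of_index1.
have inS c : flr (P i) c = 0 ->
    [set level_word i.+1 k | k in [set k | 1 <= k <= r]] (tower_word i c).
  by move=> /tower_word_level[k kr <-]; exists k.
split.
- exact: inS.
- case: s {sP} e => // /(congr1 size); rewrite size_mkseq /=; lia.
- by move=> p /mapP[w /sP[c [cc ->]] ->]; exact: inS.
- rewrite /spell /= -map_comp (eq_map (g := id)) // map_id -e -/b.
  by rewrite /tower_word -/h -/h' -symbols_uptoD subnKC // ltnW.
Qed.

Lemma symbolic_construction : has_construction_rank (subshift_of limit_word) r.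
Proof.
have r0 : 0 < r by exact: leq_ltn_trans (lab_lt (tPn 0) x0).
split => //; exists limit_word.
have /choice[B BP] : forall ij : nat * nat, exists B : building,
  is_building [set level_word ij.1 k | k in [set k | 1 <= k <= r]]
    (level_word ij.1.+1 ij.2) B /\ (ij.2 = 1 -> B.1 = level_word ij.1 1).
  by move=> ij; exact: level_building.
have rB (i : nat) : 1 <= (fun=> r) i <= r by rewrite r0 /=.
exists (@Construction r (fun=> r) level_word (fun i j => B (i.-1, j)) rB
  (fun _ _ => erefl) (fun i j _ => (BP (i, j)).1) (fun i => (BP (i, 1)).2 erefl)).
(* The words of level [i.+1] are longer than [i], so from level [k.+1] on they cover position
   [k]. *)
split => // k; exists k.+1 => // -[//|i] /= ki.
have hgt_ge n x : n < hgt (P n) (lab (P n) x).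
  elim: n x => [|n IH] x; first by have := P_tall x; lia.
  exact: leq_ltn_trans (IH x0) (P_grow _ _ _).
have k_lt : k < hgt (P i) (lab (P i) x0) by apply: leq_ltn_trans (hgt_ge i x0).
have -> : tower_word i (base_of_index i 1) = tower_word i x0.
  by apply: tower_word_state; [exact: base_of_indexP|exact: base_of_index1].
by rewrite /tower_word size_mkseq nth_mkseq.
Qed.

End Symbolic.

(** * The odometer case *)

Section OdometerDiagram.
Variables (p : nat -> nat).
Hypotheses (p_gt0 : forall n, 0 < p n) (p_dvd : forall n, p n %| p n.+1).

Definition ratio n := p n.+1 %/ p n.

Lemma ratio_gt0 n : 0 < ratio n.
Proof. by rewrite divn_gt0 // dvdn_leq. Qed.

Lemma ratioE n : ratio n * p n = p n.+1.
Proof. by rewrite divnK. Qed.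

(** One vertex per level and [ratio n] linearly ordered edges: a path is a sequence of mixed-radix
    digits. *)
Definition odometer_diagram : ordered_bratteli.
Proof.
refine (@OrderedBratteli (fun=> unit) (fun n => 'I_(ratio n))
  (fun _ _ => tt) (fun _ _ => tt) tt _ _ _ (fun n e f => e <= f) _ _ _ _).
- by case.
- by move=> n []; exists (Ordinal (ratio_gt0 n)).
- by move=> n []; exists (Ordinal (ratio_gt0 n)).
- by move=> n e.
- by move=> n e f; rewrite -eqn_leq => /eqP ef; apply: val_inj.
- by move=> n e f g; exact: leq_trans.
- by move=> n e f; rewrite leq_total eqxx.
Defined.

Local Notation B := odometer_diagram.

Definition diagram_path (d : forall n, 'I_(ratio n)) : paths B :=
  SigSub (mem_set (fun=> erefl) : (d : prod_topology (fun n => discrete_topology (edge B n))) \in paths B).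

Lemma odometer_maximal n (e : edge B n) :
  maximal_edge e <-> (e : 'I_(ratio n)).+1 = ratio n.
Proof.
split=> [me|eq f ef].
  apply/eqP; rewrite eqn_leq ltn_ord /= leqNgt; apply/negP => lt.
  by have /(congr1 val) /= := me (Ordinal lt) (leqnSn _); lia.
by apply: val_inj; have := ltn_ord (f : 'I_(ratio n)); move: ef; rewrite /= => *; lia.
Qed.

Lemma odometer_minimal n (e : edge B n) :
  minimal_edge e <-> nat_of_ord (e : 'I_(ratio n)) = 0.
Proof.
split=> [me|e0 f fe].
  by have /(congr1 val) /= <- := me (Ordinal (ratio_gt0 n)) (leq0n _).
by apply: val_inj; move: fe; rewrite /= => *; lia.
Qed.

Lemma odometer_simple : essentially_simple B.
Proof.
split.
  have lt n : (ratio n).-1 < ratio n by rewrite prednK // ratio_gt0.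
  exists (diagram_path (fun n => Ordinal (lt n))); split.
    by move=> n; apply/odometer_maximal; rewrite /= prednK // ratio_gt0.
  move=> x xM; apply: path_edge_inj => n; apply: val_inj => /=.
  by have /odometer_maximal h := xM n; apply: succn_inj; rewrite h prednK // ratio_gt0.
exists (diagram_path (fun n => Ordinal (ratio_gt0 n))); split.
  by move=> n; apply/odometer_minimal.
move=> x xM; apply: path_edge_inj => n; apply: val_inj => /=.
by have /odometer_minimal -> := xM n.
Qed.

Variables (X : topologicalType) (T : X -> X) (pos : nat -> X -> nat).
Hypotheses (cX : compact [set: X]) (p0 : p 0 = 1).
Hypotheses (pos_lt : forall n x, pos n x < p n)
  (posT : forall n x, pos n (T x) = (pos n x).+1 %% p n)
  (pos_mod : forall n x, pos n.+1 x %% p n = pos n x)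
  (pos_lc : forall n, locally_constant (pos n))
  (pos_inj : forall x y, (forall n, pos n x = pos n y) -> x = y)
  (pos_nonempty : forall n k, k < p n -> exists x, pos n x = k).

Definition digit n x := pos n.+1 x %/ p n.

Lemma digit_lt n x : digit n x < ratio n.
Proof. by rewrite ltn_divLR // ratioE. Qed.

Definition digits x := diagram_path (fun n => Ordinal (digit_lt n x)).

Lemma pos_digit n x : pos n.+1 x = digit n x * p n + pos n x.
Proof. by rewrite {1}(divn_eq (pos n.+1 x) (p n)) pos_mod. Qed.

Lemma digitE n x m c : pos n.+1 x = m * p n + c -> c < p n -> digit n x = m.
Proof. by rewrite /digit => -> cp; rewrite divnMDl // divn_small ?addn0. Qed.

Lemma digits_maximal n x :
  maximal_edge (path_edge (digits x) n) <-> (digit n x).+1 = ratio n.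
Proof. exact: odometer_maximal. Qed.

Lemma digits_minimal n x :
  minimal_edge (path_edge (digits x) n) <-> digit n x = 0.
Proof. exact: odometer_minimal. Qed.

Lemma digits_inj : injective digits.
Proof.
move=> x y xy; apply: pos_inj; elim=> [|n IH].
  by have := pos_lt 0 x; have := pos_lt 0 y; rewrite p0; lia.
have dE : digit n x = digit n y := congr1 (fun z : paths B => val (path_edge z n : 'I_(ratio n))) xy.
by rewrite !pos_digit dE IH.
Qed.

(** [k n] is the number written by the first [n] digits of [e]; the sets where [pos n] equals [k n]
    are closed, nonempty and decreasing. *)
Lemma digits_surj e : exists x, digits x = e.
Proof.
pose k := fix k n := if n is m.+1 then path_edge e m * p m + k m else 0.
have kp n : k n < p n.
  elim: n => [|n IH]; first by rewrite p0.
  have := ltn_ord (path_edge e n : 'I_(ratio n)); rewrite -ratioE /= => h.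
  by apply: (@leq_trans ((path_edge e n).+1 * p n)); [rewrite mulSn; lia|rewrite leq_mul2r h orbT].
have kmod n : k n.+1 %% p n = k n by rewrite /= modnMDl modn_small.
have [n|n x|n|x xk] := decreasing_closed_nonempty cX (F := fun n => [set x | pos n x = k n]).
- apply: closed_locally_constant.
  exact: (locally_constant_comp (fun m => m = k n) (pos_lc n)).
- by move=> /= xk; rewrite -pos_mod xk kmod.
- exact: pos_nonempty.
exists x; apply: path_edge_inj => n; apply: val_inj.
by apply: (digitE (c := k n)) => //; exact: (xk n.+1).
Qed.

(** The Vershik map is addition of 1 with carry. Below the first nonmaximal digit [k] the positions
    wrap around to 0; above it no position wraps, and the digits stay. *)
Lemma digits_vershik x : vershik_image (digits x) (digits (T x)).
Proof.
have top n : (forall i, i < n -> (digit i x).+1 = ratio i) -> (pos n x).+1 = p n.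
  elim: n => [|n IH] h; first by have := pos_lt 0 x; rewrite p0; lia.
  rewrite pos_digit -addnS IH; last by move=> i /ltnW; apply: h.
  by rewrite -ratioE -h // mulSn addnC.
have zero n : (pos n x).+1 = p n -> pos n (T x) = 0 by rewrite posT => ->; rewrite modnn.
have [xM|/existsNP exN] := pselect (forall n, (digit n x).+1 = ratio n).
  left; split=> n; first exact/digits_maximal.
  by apply/digits_minimal; rewrite /digit zero ?div0n // top.
have exN' : exists n, (digit n x).+1 != ratio n.
  by case: exN => n nN; exists n; apply/eqP.
case: (ex_minnP exN') => k kN kmin; right; exists k.
have lowmax i : i < k -> (digit i x).+1 = ratio i.
  by move=> ik; apply: contrapT => /eqP/kmin; lia.
have digit_k : (digit k x).+1 < ratio k by rewrite ltn_neqAle kN digit_lt.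
have posS n : k < n -> (pos n x).+1 < p n /\ pos n (T x) = (pos n x).+1.
  move=> kn; suff lt : (pos n x).+1 < p n by rewrite posT modn_small.
  elim: n kn => // n IH; rewrite ltnS leq_eqVlt => /predU1P[<-|kn].
    by rewrite pos_digit -addnS top // -ratioE addnC -mulSn ltn_mul2r p_gt0.
  rewrite pos_digit -ratioE; apply: (@leq_trans ((digit n x).+1 * p n)).
    by rewrite mulSn; have := IH kn; lia.
  by rewrite leq_mul2r digit_lt orbT.
have digitT : digit k (T x) = (digit k x).+1.
  apply: (digitE (c := 0)) => //.
  by rewrite (posS _ (ltnSn k)).2 pos_digit -addnS top // addn0 mulSn addnC.
split.
- by move=> /digits_maximal; lia.
- by move=> i /lowmax /digits_maximal.
- split.
  + by rewrite /path_edge /= digitT.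
  + by move=> /(congr1 val) /=; rewrite digitT; lia.
  + move=> g; rewrite /= digitT => h1 h2.
    have [e|e] : nat_of_ord (g : 'I_(ratio k)) = digit k x \/
      nat_of_ord (g : 'I_(ratio k)) = (digit k x).+1 by lia.
      by left; apply: val_inj.
    by right; apply: val_inj; rewrite /= e digitT.
- move=> i ik; apply/digits_minimal; rewrite /digit zero ?div0n //; apply: top.
  by move=> j ji; apply: lowmax; lia.
- move=> i ki; apply: val_inj; apply: (digitE (c := pos i (T x))) => //.
  rewrite (posS i ki).2 (posS i.+1 _).2; last exact: ltnW.
  by rewrite pos_digit addnS.
Qed.

Lemma cyclic_limit_rank : has_bratteli_rank T 1.
Proof.
exists B; split; [exact: odometer_simple| |by move=> n _; rewrite card_unit].
have /choice[g gK] := digits_surj.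
exists digits; split; last first.
  move=> x; have [y [_ uy]] := vershik_image_exists (digits x) odometer_simple.
  rewrite -(uy _ (digits_vershik x)); apply: uy.
  exact: vershikP odometer_simple.
apply: (homeomorphism_bij (g := g)) => //.
- by apply: hausdorff_subproduct => n; exact: discrete_hausdorff.
- apply: continuous_to_subproduct => n.
  apply: locally_constant_determined (pos_lc n.+1) => x y xy.
  by apply: val_inj; rewrite /= /digit xy.
- by move=> x; apply: digits_inj; rewrite gK.
Qed.

End OdometerDiagram.

(** * Periodic itineraries and finite cyclic factors *)

Section Periodic.
Variables (X : topologicalType) (T U : X -> X).
Hypotheses (TK : cancel T U) (UK : cancel U T).
Hypotheses (cT : continuous T) (cU : continuous U).
Hypotheses (cX : compact [set: X]) (mT : minimal_system T).
Variables (r : nat) (P : nat -> tower X) (x0 : X).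
Hypotheses (tP : tower_seq T r P) (perP : forall n, periodic_at T U (P n)).

Let lcT (A : Type) (f : X -> A) k : locally_constant f -> locally_constant (fun x => f (iter k T x)).
Proof.
move=> lf; apply: (@locally_constant_continuous_comp _ _ _ f (ziter T U (Posz k))) => //.
exact: ziter_continuous.
Qed.

Definition is_period n q := 0 < q /\ forall x, state (P n) (iter q T x) = state (P n) x.

(* Periodicity along one forward orbit is a closed condition, hence global. *)
Lemma period_from n q x : 0 < q ->
  (forall k, state (P n) (iter q T (iter k T x)) = state (P n) (iter k T x)) -> is_period n q.
Proof.
move=> q0 xq; split => // y; apply: contrapT => nyq.
have lP := tower_locally_constant (tower_seq_tower tP n).
have [||k] := @forward_dense _ _ _ TK cT cU cX mT x
    (fun y => state (P n) (iter q T y) <> state (P n) y).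
- by apply: locally_constant_comp (fun s => s.1 <> s.2) _ (locally_constant_pair (lcT q lP) lP).
- by exists y.
- by [].
Qed.

Definition period n := least (is_period n).

Lemma periodP n : is_period n (period n) /\ forall q, is_period n q -> period n <= q.
Proof.
have [x [q [q0 xq]]] := perP n; apply: (@leastP _ q).
apply: (@period_from n q x) => // k.
by rewrite -iterD addnC; exact: (xq (Posz k)).
Qed.

Lemma period_gt0 n : 0 < period n. Proof. by case: (periodP n) => -[]. Qed.

Lemma state_modn n k x : state (P n) (iter k T x) = state (P n) (iter (k %% period n) T x).
Proof.
rewrite {1}(divn_eq k (period n)); elim: (k %/ period n) => [|m IH]; first by rewrite add0n.
by rewrite mulSn -addnA iterD (periodP n).1.2.
Qed.

(** Modulo [period n], the phase is a factor map onto a finite cycle. *)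
Definition phase n i y :=
  forall t, state (P n) (iter t T y) = state (P n) (iter (t + i) T x0).

Lemma phase_modn n i y : phase n i y -> phase n (i %% period n) y.
Proof.
by move=> yi t; rewrite yi state_modn [in RHS]state_modn modnDmr.
Qed.

Lemma phase_locally_constant n i : locally_constant (phase n i).
Proof.
have lP := tower_locally_constant (tower_seq_tower tP n).
move=> y; apply: filterS (locally_constant_all (period n) (fun k => lcT k lP) y).
move=> z zy; apply/propext; split=> h t; rewrite state_modn.
  by rewrite -zy ?ltn_pmod ?period_gt0 // -state_modn.
by rewrite zy ?ltn_pmod ?period_gt0 // -state_modn.
Qed.

(** Having no phase is a locally constant property that fails along the forward orbit of [x0], so by
    density it fails everywhere. *)
Lemma phase_exists n y : exists i, phase n i y.
Proof.
apply: contrapT => ny.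
have [||k] := @forward_dense _ _ _ TK cT cU cX mT x0 (fun y => ~ exists i, phase n i y).
- have lP := tower_locally_constant (tower_seq_tower tP n).
  move=> z; apply: filterS (locally_constant_all (period n) (fun k => lcT k lP) z).
  move=> w wz; apply/propext; split=> h [i hi]; apply: h; exists i => t; rewrite state_modn.
    by rewrite wz ?ltn_pmod ?period_gt0 // -state_modn.
  by rewrite -wz ?ltn_pmod ?period_gt0 // -state_modn.
- by exists y.
- by apply; exists k => t; rewrite -iterD.
Qed.

(** The difference of two distinct phases would be a period smaller than the least one. *)
Lemma phase_unique n i j y : phase n i y -> phase n j y -> i <= j -> j < period n -> i = j.
Proof.
move=> yi yj ij jp; apply/eqP; rewrite eqn_leq ij leqNgt; apply/negP => lt.
have : is_period n (j - i).
  apply: (@period_from n (j - i) (iter i T x0)); first by rewrite subn_gt0.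
  move=> k; rewrite -!iterD -(yi k) (_ : j - i + k + i = k + j); last by lia.
  by rewrite -yj.
by move=> /(periodP n).2; lia.
Qed.

Definition phase_of n y := least [set i | i < period n /\ phase n i y].

Lemma phase_ofP n y : phase_of n y < period n /\ phase n (phase_of n y) y.
Proof.
have [i /phase_modn yi] := phase_exists n y.
by have [] := @leastP [set i | i < period n /\ phase n i y] (i %% period n) (conj (ltn_pmod _ (period_gt0 n)) yi).
Qed.

Lemma phase_of_eq n i y : phase n i y -> phase_of n y = i %% period n.
Proof.
move=> /phase_modn yi; have [lt ph] := phase_ofP n y.
have lt' := ltn_pmod i (period_gt0 n).
case: (leqP (phase_of n y) (i %% period n)) => [le|/ltnW le].
  exact: phase_unique ph yi le lt'.
by apply/esym; exact: phase_unique yi ph le lt.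
Qed.

Lemma phase_refines n i y : phase n.+1 i y -> phase n i y.
Proof. by move=> yi t; apply: (tower_seq_refines tP n).1. Qed.

Lemma period_dvd n : period n %| period n.+1.
Proof.
have a : phase n 0 x0 by move=> t; rewrite addn0.
have b : phase n.+1 (period n.+1) x0.
  by move=> t; rewrite addnC iterD (periodP n.+1).1.2.
by have := phase_of_eq a; rewrite (phase_of_eq (phase_refines b)) mod0n => /eqP.
Qed.

Lemma periodic_rank1 : has_bratteli_rank T 1.
Proof.
(* Index 0 is the one-point cycle below the top vertex; the partition [P m] enters at index
   [m.+1]. *)
pose p n := if n is m.+1 then period m else 1.
pose pos n := if n is m.+1 then phase_of m else fun=> 0.
apply: (@cyclic_limit_rank p _ _ X T pos) => //.
- by case=> //= n; exact: period_gt0.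
- by case=> [|n] /=; [exact: dvd1n|exact: period_dvd].
- by case=> //= n x; have [] := phase_ofP n x.
- case=> [|n] x /=; first by rewrite modn1.
  apply: phase_of_eq => t; have [_ /(_ t.+1)] := phase_ofP n x.
  by rewrite iterSr addSn addnS => ->.
- case=> [|n] x /=; first by rewrite modn1.
  by apply/esym; apply: phase_of_eq; apply: phase_refines; apply: (phase_ofP _ _).2.
- case=> [|n] x /=; first exact: filterE.
  have [_ h] := phase_ofP n x; apply: filterS (phase_locally_constant n (phase_of n x) x).
  move=> y yx; have : phase n (phase_of n x) y by rewrite yx.
  by move=> /phase_of_eq yE; rewrite /= yE modn_small //; case: (phase_ofP n x).
- move=> x y xy; apply: (tower_seq_separates tP) => n.
  have [_ /(_ 0) hx] := phase_ofP n x; have [_ /(_ 0) hy] := phase_ofP n y.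
  have e : phase_of n x = phase_of n y := xy n.+1.
  by move: hx hy; rewrite e /= => -> ->.
- case=> [|n] k /=; first by case: k => // _; exists x0.
  move=> kp; exists (iter k T x0); rewrite -(modn_small kp); apply: phase_of_eq.
  by move=> t; rewrite -iterD modn_small.
Qed.

End Periodic.

(** * Towers of a Bratteli diagram *)

Section DiagramTowers.
Variable D : ordered_bratteli.

(** The number of finite paths from the top vertex to the given one. *)
Fixpoint height n : vertex D n -> nat :=
  match n return vertex D n -> nat with
  | 0 => fun=> 1
  | m.+1 => fun v => \sum_(e : edge D m | rng e == v) height (src e)
  end.

Definition rank_below n (e : edge D n) :=
  \sum_(f | edge_le f e && (f != e)) height (src f).

Definition path_vertex (x : paths D) n := src (path_edge x n).

(* The number of finite paths preceding the first [n] edges of [x]. *)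
Fixpoint path_floor (x : paths D) n :=
  if n is m.+1 then rank_below (path_edge x m) + path_floor x m else 0.

Lemma height_gt0 n (v : vertex D n) : 0 < height v.
Proof.
elim: n v => //= n IH v; have [e ev] := rng_surj v.
by rewrite (bigD1 e) ?ev //= ltn_addr.
Qed.

Lemma edge_le_rng n (e f : edge D n) : edge_le e f -> rng e = rng f.
Proof. by move=> ef; apply/eqP; rewrite -edge_comparable ef. Qed.

Lemma rank_belowD n (e : edge D n) :
  rank_below e + height (src e) = \sum_(f | edge_le f e) height (src f).
Proof. by rewrite addnC /rank_below [in RHS](bigD1 e) //= edge_le_refl. Qed.

Lemma leq_sum_subpred (I : finType) (A C : pred I) (F : I -> nat) :
  (forall i, A i -> C i) -> \sum_(i | A i) F i <= \sum_(i | C i) F i.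
Proof.
move=> AC; rewrite [leqRHS](bigID A) /= (eq_bigl A) ?leq_addr // => i.
by case Ai : (A i); rewrite ?andbF // AC.
Qed.

Lemma rank_below_lt n (e f : edge D n) : edge_le e f -> e <> f ->
  rank_below e + height (src e) <= rank_below f.
Proof.
move=> ef nef; rewrite rank_belowD; apply: leq_sum_subpred => g ge.
rewrite (edge_le_trans ge ef); apply/eqP => gf; apply: nef.
by apply: (@edge_le_anti D n); rewrite ef -gf.
Qed.

Lemma rank_below_successor n (e f : edge D n) : successor_edge e f ->
  rank_below f = rank_below e + height (src e).
Proof.
move=> [ef nef sf]; apply/eqP; rewrite eqn_leq rank_below_lt ?andbT //; last exact/nesym.
rewrite rank_belowD; apply: leq_sum_subpred => g /andP[gf /eqP ngf].
have : edge_le g e || edge_le e g.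
  by rewrite edge_comparable (edge_le_rng gf) (edge_le_rng ef).
case/orP => // eg; case: (sf g eg gf) => // ->; exact: edge_le_refl.
Qed.

Lemma rank_below_leq n (e : edge D n) :
  rank_below e + height (src e) <= height (rng e).
Proof. by rewrite rank_belowD; apply: leq_sum_subpred => f /edge_le_rng ->. Qed.

Lemma rank_below_maximal n (e : edge D n) : maximal_edge e ->
  rank_below e + height (src e) = height (rng e).
Proof.
move=> me; apply/eqP; rewrite eqn_leq rank_below_leq rank_belowD /=.
apply: leq_sum_subpred => f /eqP fe.
have : edge_le f e || edge_le e f by rewrite edge_comparable fe.
by case/orP => // /me ->; exact: edge_le_refl.
Qed.

Lemma rank_below_minimal n (e : edge D n) : minimal_edge e <-> rank_below e = 0.
Proof.
split=> [me|/eqP]; first by rewrite /rank_below big1 // => f /andP[/me -> /eqP].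
rewrite sum_nat_eq0 => /forallP h f fe; apply: contrapT => /eqP nfe.
by have := h f; rewrite fe nfe /= -leqn0 leqNgt height_gt0.
Qed.

Lemma path_vertexS x n : rng (path_edge x n) = path_vertex x n.+1.
Proof. exact: path_edgeP. Qed.

Lemma path_floor_lt x n : path_floor x n < height (path_vertex x n).
Proof.
elim: n => [|n IH]; first exact: height_gt0.
rewrite -path_vertexS; apply: leq_trans (rank_below_leq _).
by rewrite /= -addnS leq_add2l.
Qed.

Lemma path_floor_top x n : (forall i, i < n -> maximal_edge (path_edge x i)) ->
  (path_floor x n).+1 = height (path_vertex x n).
Proof.
elim: n => [//|n IH] h; rewrite -path_vertexS -rank_below_maximal; last exact: h.
by rewrite /= -addnS IH // => i /ltnW; exact: h.
Qed.

Lemma path_floor_eq0 x n : (forall i, i < n -> minimal_edge (path_edge x i)) <->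
  path_floor x n = 0.
Proof.
elim: n => [//|n IH] /=; split=> [h|/eqP].
  rewrite (rank_below_minimal _).1 ?add0n; last exact: h.
  by apply/IH => i /ltnW; exact: h.
rewrite addn_eq0 => /andP[/eqP/rank_below_minimal hn /eqP/IH h] i.
by rewrite ltnS leq_eqVlt => /predU1P[->|/h].
Qed.

(** As in division with remainder, the edges into one vertex own disjoint intervals of floors,
    starting at [rank_below] and as long as the height of the source; the floor thus determines the
    edge. *)
Lemma path_floor_inj x y n : path_vertex x n.+1 = path_vertex y n.+1 ->
  path_floor x n.+1 = path_floor y n.+1 ->
  path_edge x n = path_edge y n /\ path_floor x n = path_floor y n.
Proof.
rewrite -!path_vertexS /= => vE fE.
have eE : path_edge x n = path_edge y n.
  apply: contrapT => ne; have hx := path_floor_lt x n; have hy := path_floor_lt y n.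
  have : edge_le (path_edge x n) (path_edge y n) || edge_le (path_edge y n) (path_edge x n).
    by rewrite edge_comparable vE.
  rewrite /path_vertex in hx hy.
  case/orP => /rank_below_lt le; [have := le ne|have := le (nesym ne)]; lia.
by split => //; move: fE; rewrite eE => /addnI.
Qed.

Lemma vershik_floor x n : essentially_simple D ->
  ((path_floor x n).+1 = height (path_vertex x n) /\ path_floor (vershik x) n = 0) \/
  (path_vertex (vershik x) n = path_vertex x n /\
   path_floor (vershik x) n = (path_floor x n).+1).
Proof.
move=> /(vershikP x); set y := vershik x => -[[xM ym]|[k [_ lowM sk lowm high]]].
  by left; split; [exact: path_floor_top|apply/path_floor_eq0].
have [nk|] := leqP n k.
  left; split; first by apply: path_floor_top => i ik; apply: lowM; lia.
  by apply/path_floor_eq0 => i ik; apply: lowm; lia.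
right; elim: n i => // n IH; rewrite ltnS leq_eqVlt => /predU1P[<-|kn].
  have [ek nek _] := sk; split; first by rewrite -!path_vertexS (edge_le_rng ek).
  rewrite /= (rank_below_successor sk) (path_floor_eq0 y k).1 // addn0.
  by rewrite -addnS path_floor_top.
by rewrite -!path_vertexS /= high // (IH kn).2 addnS.
Qed.

Lemma path_edge_locally_constant n : locally_constant (fun x : paths D => path_edge x n).
Proof.
move=> x.
have /(_ x [set set_val x n]) := @coordinate_continuous _ _ (paths D) n; apply.
exact: discrete_set1.
Qed.

(** Level [n.+1] is used because the rank bounds the number of vertices only from level 1 on. The
    sum in the height has a single term at an actual label, which avoids turning a number back into
    a vertex. *)
Definition diagram_tower n : tower (paths D) := Tower
  (fun x => enum_rank (path_vertex x n.+1))
  (fun x => path_floor x n.+1)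
  (fun k => \sum_(v : vertex D n.+1 | enum_rank v == k :> nat) height v).

Lemma hgt_diagram_tower n x :
  hgt (diagram_tower n) (lab (diagram_tower n) x) = height (path_vertex x n.+1).
Proof.
rewrite /= (eq_bigl (pred1 (path_vertex x n.+1))) ?big_pred1_eq // => v /=.
by rewrite (inj_eq val_inj) (inj_eq enum_rank_inj).
Qed.

Lemma diagram_state n x y : state (diagram_tower n) x = state (diagram_tower n) y <->
  path_vertex x n.+1 = path_vertex y n.+1 /\ path_floor x n.+1 = path_floor y n.+1.
Proof.
rewrite /state; split=> [[/val_inj/enum_rank_inj a b]|[a b]] //.
by rewrite /= a; congr pair.
Qed.

Lemma diagram_towerP n : essentially_simple D ->
  is_tower (@vershik D) #|vertex D n.+1| (diagram_tower n).
Proof.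
move=> sD; split.
- by move=> x; exact: ltn_ord.
- by move=> x; rewrite hgt_diagram_tower; exact: path_floor_lt.
- move=> x; rewrite hgt_diagram_tower.
  case: (vershik_floor x n.+1 sD) => [[a b]|[a b]]; [by left|right].
  by rewrite /state /= a; congr pair.
- have lc : locally_constant (fun x => (path_edge x n, path_floor x n.+1)).
    apply: locally_constant_pair; first exact: path_edge_locally_constant.
    elim: (n.+1) => [|m IH] x; first exact: filterE.
    apply: filterS2 (path_edge_locally_constant m x) (IH x) => y /= yx1 yx2.
    by rewrite yx1 yx2.
  apply: locally_constant_determined lc => x y [a b].
  by apply/diagram_state; rewrite -!path_vertexS a.
Qed.

Lemma diagram_tower_refines n : refines (diagram_tower n.+1) (diagram_tower n).
Proof.
split=> [x y /diagram_state[a b]|x].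
  have [e f] := path_floor_inj a b; apply/diagram_state; split => //.
  by rewrite /path_vertex e.
by rewrite [flr _ _]/= -/(path_floor x n.+1) => /eqP; rewrite addn_eq0 => /andP[_ /eqP].
Qed.

Lemma diagram_tower_separates x y :
  (forall n, state (diagram_tower n) x = state (diagram_tower n) y) -> x = y.
Proof.
move=> xy; apply: path_edge_inj => n; have /diagram_state[a b] := xy n.
by have [] := path_floor_inj a b.
Qed.

Lemma diagram_tower_base x : (forall n, flr (diagram_tower n) x = 0) -> minimal_path x.
Proof. by move=> x0 n; apply: (path_floor_eq0 x n.+1).2 => //; exact: x0. Qed.

End DiagramTowers.

Lemma bratteli_tower_seq (X : topologicalType) (T : X -> X) d :
  has_bratteli_rank T d -> exists P, tower_seq T d P.
Proof.
move=> [B [sB [phi [[psi [phiK psiK cphi cpsi]] phiT]] card]].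
exists (fun n => Tower (lab (diagram_tower B n) \o phi) (flr (diagram_tower B n) \o phi)
  (hgt (diagram_tower B n))).
have tB n : is_tower (@vershik B) d (diagram_tower B n).
  exact: is_tower_leq (card n.+1 _) (diagram_towerP n sB).
split.
- move=> n; split=> [x|x|x|].
  + exact: lab_lt (tB n) (phi x).
  + exact: flr_lt (tB n) (phi x).
  + by rewrite /state /= phiT; exact: tower_step (tB n) (phi x).
  + apply: (@locally_constant_continuous_comp _ _ _ (state (diagram_tower B n)) phi) => //.
    exact: tower_locally_constant (tB n).
- move=> n; have [a b] := diagram_tower_refines B n.
  by split=> [x y|x]; [exact: (a (phi x) (phi y))|exact: (b (phi x))].
- move=> x y xy; apply: (can_inj phiK); apply: diagram_tower_separates => n; exact: xy.
- move=> x y x0 y0; apply: (can_inj phiK); have [_ [z [_ uz]]] := sB.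
  by rewrite -(uz (phi x) (diagram_tower_base x0)) -(uz (phi y) (diagram_tower_base y0)).
Qed.

Lemma minimal_essentially_minimal (X : topologicalType) (T : X -> X) :
  injective T -> T @` setT = setT -> [set: X] !=set0 -> minimal_system T ->
  essentially_minimal T.
Proof.
move=> iT sT nX mT.
have all Y : closed_invariant T Y -> Y = setT.
  move=> [[y Yy] cY TY]; apply/seteqP; split => // x _; apply: contrapT => nYx.
  have fwd n : Y (iter n T y) by elim: n => //= n IH; rewrite -TY; exists (iter n T y).
  have bwd n w : Y (iter n T w) -> Y w.
    elim: n => //= n IH; rewrite -{1}TY => -[v Yv /iT vE]; apply: IH; rewrite -vE //.
  have [||w [nYw [n [wE|yE]]]] := mT y (~` Y); first by exists x.
  - by rewrite openC.
  - by apply: nYw; rewrite wE.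
  - by apply: nYw; apply: (bwd n); rewrite -yE.
have iX : closed_invariant T [set: X] by split => //; exact: closedT.
exists setT; split; last by move=> Y [/all ->].
by split => // Z /all.
Qed.

Lemma bratteli_rank_gt0 (X : topologicalType) (T : X -> X) d :
  has_bratteli_rank T d -> 0 < d.
Proof.
move=> [B [_ _ card]]; apply: leq_trans (card 1 (leqnn _)).
have [e _] := src_surj (top_vertex B); apply/card_gt0P.
by exists (rng e).
Qed.

(** * Telescoping and the final dichotomy *)

Section Main.
Variables (X : topologicalType) (T U : X -> X).
Hypotheses (TK : cancel T U) (UK : cancel U T).
Hypotheses (cT : continuous T) (cU : continuous U).
Hypotheses (cX : compact [set: X]) (hX : hausdorff_space X).
Hypotheses (pX : perfect_set [set: X]) (mT : minimal_system T).

Lemma tower_seq_tall r (P : nat -> tower X) :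
  tower_seq T r P -> (exists n, expansive_at T U (P n)) ->
  exists Q : nat -> tower X, [/\ tower_seq T r Q, expansive_at T U (Q 0),
    forall x, r + 5 < hgt (Q 0) (lab (Q 0) x) &
    forall n x y, hgt (Q n) (lab (Q n) x) < hgt (Q n.+1) (lab (Q n.+1) y)].
Proof.
move=> tP [n0 ex].
have PP := tower_subseq_refines (tower_seq_refines tP).
(* The sum dominates every height of [P n], and [r + 5] is the room that the coding of labels
   requires. *)
pose bound n := \sum_(k < r) hgt (P n) k + r + 5.
have le_bound n x : hgt (P n) (lab (P n) x) <= bound n.
  have lt := lab_lt (tower_seq_tower tP n) x.
  by rewrite /bound (bigD1 (Ordinal lt)) //= -!addnA leq_addr.
have /choice[next nextP] : forall n, exists m, n < m /\
    forall x, bound n < hgt (P m) (lab (P m) x).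
  move=> n; have [m mP] := hgt_unbounded TK UK cT cU cX hX pX mT (bound n) tP.
  exists (maxn n.+1 m); split; first by rewrite leq_maxl.
  apply: (hgt_refines UK (tower_seq_tower tP m) (tower_seq_tower tP _) _ mP).
  by apply: PP; rewrite leq_maxr.
(* The sequence starts one step after [n0], so that its first partition is already tall; it stays
   expansive as a refinement of [P n0]. *)
pose ns k := iter k.+1 next n0.
have ns_lt k : ns k < ns k.+1 by have [] := nextP (ns k).
have ns_ge k : k <= ns k by elim: k => // k IH; exact: leq_ltn_trans (ns_lt k).
exists (fun k => P (ns k)); split.
- apply: (tower_seq_interleave (f := ns) tP) => // n.
  + exact: tower_seq_tower tP _.
  + by apply: PP; exact: ltnW.
- have rf : refines (P (ns 0)) (P n0) by apply: PP; apply: ltnW; case: (nextP n0).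
  by move=> x y xy; apply: ex => z; exact: rf.1.
- by move=> x; have [_ /(_ x)] := nextP n0; apply: leq_trans; rewrite /bound; lia.
- by move=> n x y; have [_ /(_ y)] := nextP (ns n); apply: leq_ltn_trans.
Qed.

Lemma tower_seq_basepoint r (P : nat -> tower X) (x : X) : tower_seq T r P ->
  exists x0, forall n, flr (P n) x0 = 0.
Proof.
move=> tP; apply: (decreasing_closed_nonempty (F := fun n => [set x | flr (P n) x = 0])) => //.
- move=> n; apply: closed_locally_constant.
  exact: (locally_constant_comp (fun s : nat * nat => s.2 = 0)
    (tower_locally_constant (tower_seq_tower tP n))).
- by move=> n y; exact: (tower_seq_refines tP n).2.
- move=> n; exists (iter (flr (P n) x) U x).
  exact: (flr_base UK (tower_seq_tower tP n) x).
Qed.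

Lemma odometer_or_symbolic (x : X) r : has_bratteli_rank T r ->
  has_bratteli_rank T 1 \/ exists V : nat -> bool,
    conjugate T (subshift_map (subshift_of_subshift V)) /\
    exists2 r', r' <= r & has_construction_rank (subshift_of V) r'.
Proof.
move=> /bratteli_tower_seq[P tP].
have [r' [Q [rr tQ [ex|per]]]] := tower_seq_dichotomy TK UK tP; [right|left].
  have [S [tS exS tall grow]] := tower_seq_tall tQ ex.
  have [x0 x0P] := tower_seq_basepoint x tS.
  exists (limit_word T S x0); split; first exact: (symbolic_conjugate TK UK cT cU cX mT x0 tS exS tall).
  exists r' => //; exact: (symbolic_construction tS tall grow x0P).
exact: (periodic_rank1 TK cT cU cX mT x tQ per).
Qed.

End Main.

Theorem theorem6p9 (R : realType) (X : topologicalType) (T : X -> X) :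
  cantor_system R T -> minimal_system T -> finite_topological_rank T ->
  (odometer R T \/
   exists V : nat -> bool,
     [/\ minimal_system (subshift_map (subshift_of_subshift V)),
         finite_symbolic_rank (subshift_of V) &
         conjugate T (subshift_map (subshift_of_subshift V))]) /\
  (~ odometer R T ->
   exists V : nat -> bool,
     [/\ minimal_system (subshift_map (subshift_of_subshift V)),
         finite_symbolic_rank (subshift_of V),
         conjugate T (subshift_map (subshift_of_subshift V)) &
         symbolic_rank (subshift_of V) <= topological_rank T]).
Proof.
move=> CT mT [d0 rd0].
have [rd dmin] := @leastP (has_bratteli_rank T) _ rd0.
rewrite -/(topological_rank T) in rd dmin.
have [[pX cX hX _] _ [U [TK UK cT cU]]] := CT.
have [x] : [set: X] !=set0.
  by have [B [[[b _] _] [phi [[psi _] _]] _]] := rd; exists (psi b).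
move=> _.
(* Starting from a diagram that attains the topological rank makes [r] at most that rank. In the
   first case the rank is 1, so the system is an odometer. *)
have [r1|[V [cV [r rd' rV]]]] := odometer_or_symbolic TK UK cT cU cX hX pX mT x rd.
  have odo : odometer R T.
    split => //; [|by exists d0|].
      apply: minimal_essentially_minimal => //; first exact: can_inj TK.
      + by apply/seteqP; split => // y _; exists (U y).
      + by exists x.
    by apply/eqP; rewrite eqn_leq dmin //= (bratteli_rank_gt0 rd).
  by split; [left|].
have mV := conjugate_minimal cV mT.
have fV : finite_symbolic_rank (subshift_of V) by exists r.
split; [by right; exists V|move=> _; exists V; split => //].
apply: leq_trans rd'; have [_] := @leastP (has_construction_rank (subshift_of V)) _ rV.
exact.
Qed.
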